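(* Let $H$ be a separable Hilbert space, let $[a,b]$ be a finite interval, and let $\{A_n\}_{n\ge1}$ be a sequence of self-adjoint operators in $H$ with absolutely continuous spectrum on $[a,b]$. Let $\Phi\subset H$ be a dense set such that the strong limit $\lim_{n\to\infty}A_n$ exists on $\Phi$ and the closure of this limit operator is a self-adjoint operator $A$ with simple spectrum and generating vector $e_0$. Let $E_\lambda^{(n)}$ and $E_\lambda$ be the resolutions of the identity of $A_n$ and $A$ respectively, and let $$\sigma_n(\lambda)=(E^{(n)}_\lambda e_0,e_0)=\sigma_n(a)+\int_a^\lambda f_n(t)\,dt,\qquad \sigma(\lambda)=(E_\lambda e_0,e_0),\qquad \lambda\in[a,b].$$ If there exist a constant $C>0$ and a positive function $g\in L_p[a,b]$ ($p\ge1$) such that $C\le f_n(t)\le g(t)$ for all $n\in\mathbb N$ and almost all $t\in[a,b]$, then the spectrum of $A$ on $[a,b]$ is purely absolutely continuous, $$\sigma(\lambda)=\sigma(a)+\int_a^\lambda f(t)\,dt,\qquad\lambda\in[a,b],$$ and $f\in L_p[a,b]$. Moreover, under these conditions the sequence $\sigma_n(\lambda)$ converges to $\sigma(\lambda)$ uniformly on $[a,b]$.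
   Context: Operators may be unbounded; $\Phi$ is contained in the domains of the operators involved, and the closure of the limit operator on $\Phi$ is the operator whose graph is the closure in $H\times H$ of $\{(e,\lim_nA_ne):e\in\Phi\}$ (so $\|(A_n-A)e\|\to0$ for $e\in\Phi$). A self-adjoint operator $T$ with resolution of the identity (spectral family) $E^T_\lambda$ has absolutely continuous spectrum on $[a,b]$ if for every $e\in H$ the function $\lambda\mapsto(E^T_\lambda e,e)$ is absolutely continuous on $[a,b]$. The spectrum of $A$ on $[a,b]$ is purely absolutely continuous if $[a,b]\subseteq\sigma(A)$ and $A$ has absolutely continuous spectrum on $[a,b]$ in this sense. $A$ has simple spectrum with generating vector $e_0$ if the closed linear span of the vectors $E(\Delta)e_0$, with $\Delta$ ranging over intervals of $\mathbb R$, is all of $H$, where $E(\cdot)$ is the spectral measure of $A$.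
   Formalization: At the endpoints of [a,b] the resolutions of the identity are taken as limits from inside (E_b is E((-oo,b)), otherwise E((-oo,l])); with one one-sided convention throughout, the claim fails when A has an eigenvalue at b (or at a), e.g. A_n = t (+) (b+1/n) on L^2[a,b] (+) C. *)

(* Defs.v *)
From HB Require Import structures.
From mathcomp Require Import all_boot all_order all_algebra.
From mathcomp Require Import sesquilinear complex.
From mathcomp Require Import all_classical all_reals all_analysis.

Set Implicit Arguments.
Unset Strict Implicit.
Unset Printing Implicit Defensive.

Import Order.TTheory GRing.Theory Num.Theory.
Import numFieldNormedType.Exports.

Local Open Scope classical_set_scope.
Local Open Scope ring_scope.
Local Open Scope complex_scope.

(* Complex Hilbert spaces; [inner] is linear in its first argument. *)
HB.mixin Record isHilbert (R : realType) H & CompleteNormedModule R[i] H := {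
  inner : {dot H for (@Num.conj R[i])} ;
  normr_inner : forall x : H, `|x| ^+ 2 = inner x x
}.

#[short(type="hilbertType")]
HB.structure Definition Hilbert (R : realType) :=
  {H of isHilbert R H & CompleteNormedModule R[i] H}.

Definition separable (T : topologicalType) :=
  exists2 D : set T, countable D & dense D.

Section inner_theory.
Context {R : realType} {H : hilbertType R}.
Implicit Types x y z : H.

Lemma ReD (a b : R[i]) : complex.Re (a + b) = complex.Re a + complex.Re b.
Proof. by case: a b => [? ?] [? ?]. Qed.

Lemma Re_sum n (F : 'I_n -> R[i]) :
  complex.Re (\sum_(i < n) F i) = \sum_(i < n) complex.Re (F i).
Proof. by elim/big_rec2: _ => //= i y1 y2 _ <-; rewrite ReD. Qed.

Lemma ReB (a b : R[i]) : complex.Re (a - b) = complex.Re a - complex.Re b.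
Proof. by case: a b => [? ?] [? ?]. Qed.

Lemma inner_CauchySchwarz x y : `|inner x y| <= `|x| * `|y|.
Proof.
have [->|y0] := eqVneq y 0; first by rewrite linear0r !normr0 mulr0.
have yy0 : 0 < (inner y y : R[i]) by rewrite dnorm_gt0.
rewrite -(@ler_pXn2r _ 2) ?nnegrE ?mulr_ge0// exprMn !normr_inner.
have := dnorm_ge0 (@inner R H) (inner y y *: x - inner x y *: y).
have cyy : Num.conj (inner y y) = inner y y :> R[i] by rewrite geC0_conj// ltW.
rewrite dnormB !dnormZ linearZl_LR linearZr_LR /=.
rewrite -normCKC; set b := `|inner x y| ^+ 2; set c := inner y y.
rewrite (@geC0_conj _ (c * b)); last by rewrite mulr_ge0 ?exprn_ge0// ltW.
have -> : `|c| ^+ 2 = c ^+ 2 by rewrite gtr0_norm.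
have -> : c ^+ 2 * inner x x + b * c - (c * b + c * b) = c * (inner x x * c - b).
  by rewrite mulrBr expr2 (mulrC b) addrKA mulrA mulrAC mulrA.
by rewrite pmulr_rge0// subr_ge0.
Qed.

Lemma Re_inner_cvg (u : nat -> H) (l y : H) : u @ \oo --> l ->
  complex.Re (inner (u n) y) @[n --> \oo] --> complex.Re (inner l y).
Proof.
move=> /cvgrPdist_lt ul; apply/cvgrPdist_lt => e e0.
have d0 : 0 < e%:C / (`|y| + 1) :> R[i].
  by rewrite divr_gt0 ?ltcR// ltr_wpDl.
near=> n.
rewrite -ReB -linearBl/= -ltcR.
apply: le_lt_trans (normc_ge_Re _) _.
apply: le_lt_trans (inner_CauchySchwarz _ _) _.
have : `|l - u n| < e%:C / (`|y| + 1) by near: n; exact: ul.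
rewrite ltr_pdivlMr ?ltr_wpDl// mulrDr mulr1; apply: le_lt_trans.
by rewrite lerDl.
Unshelve. all: by end_near. Qed.


End inner_theory.


(* Possibly unbounded operators: only the values of [app] on [dom] matter. *)
Record operator (R : realType) (H : hilbertType R) := Operator {
  dom : set H ;
  app :> H -> H ;
  dom0 : dom 0 ;
  dom_lin : forall (c : R[i]) x y, dom x -> dom y -> dom (c *: x + y) ;
  app_lin : forall (c : R[i]) x y, dom x -> dom y ->
    app (c *: x + y) = c *: app x + app y
}.

Section operators.
Context {R : realType} {H : hilbertType R}.
Implicit Types (A : operator H) (z : R[i]).

Definition graph A : set (H * H) := [set (x, A x) | x in dom A].

Definition adjoint_graph A : set (H * H) :=
  [set yw | forall x, dom A x -> inner (A x) yw.1 = inner x yw.2].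

Definition self_adjoint A := dense (dom A) /\ adjoint_graph A = graph A.

Definition resolvent_set A : set R[i] :=
  [set z | exists S : {linear H -> H}, [/\ continuous S,
     forall y, dom A (S y) /\ A (S y) - z *: S y = y &
     forall x, dom A x -> S (A x - z *: x) = x]].

Definition spectrum A : set R[i] := ~` resolvent_set A.

(* The graph of the strong limit of [A_ n] on [Phi], before closure. *)
Definition limit_graph (A_ : nat -> operator H) (Phi : set H) : set (H * H) :=
  [set (e, lim (A_ n e @[n --> \oo])) | e in Phi].

Definition linear_span (S : set H) : set H :=
  [set x | exists n (c : 'I_n -> R[i]) (v : 'I_n -> H),
     (forall i, S (v i)) /\ x = \sum_(i < n) c i *: v i].

Definition orthogonal_projection (Q : H -> H) :=
  [/\ linear Q, forall x, Q (Q x) = Q x &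
      forall x y, inner (Q x) y = inner x (Q y)].

End operators.

(* Projection-valued measures on the Borel sets of R. *)
Record pvm (R : realType) (H : hilbertType R) := PVM {
  pvm_fun :> set R -> H -> H ;
  pvm_proj : forall B, measurable B -> orthogonal_projection (pvm_fun B) ;
  pvm0 : forall x, pvm_fun set0 x = 0 ;
  pvmT : forall x, pvm_fun setT x = x ;
  pvm_sigma_additive : forall F : nat -> set R,
    (forall k, measurable (F k)) -> trivIset setT F ->
    forall x, \sum_(k < n) pvm_fun (F k) x @[n --> \oo]
              --> pvm_fun (\bigcup_k F k) x
}.

Section scalar_measure.
Context {R : realType} {H : hilbertType R}.
Variables (P : pvm H) (x : H).

(* On Borel sets [`|P B x| ^+ 2 = (P B x, x)], see [scalar_measureE]; the norm
   form is nonnegative on every set, as the library asks of a measure. *)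
Definition scalar_measure (B : set R) : \bar R :=
  (complex.Re (`|P B x| ^+ 2))%:E.

Lemma scalar_measureE B : measurable B ->
  scalar_measure B = (complex.Re (inner (P B x) x))%:E.
Proof.
move=> mB; have [_ PK PC] := pvm_proj P mB.
by rewrite /scalar_measure normr_inner PC PK -PC.
Qed.

Let scalar_measure0 : scalar_measure set0 = 0%E.
Proof. by rewrite /scalar_measure pvm0 normr0 expr0n. Qed.

Let scalar_measure_ge0 B : (0 <= scalar_measure B)%E.
Proof.
rewrite lee_fin; have := exprn_ge0 2 (normr_ge0 (P B x)).
by rewrite lecE => /andP[].
Qed.

Let scalar_measure_sigma_additive : semi_sigma_additive scalar_measure.
Proof.
move=> F mF tF mUF; rewrite scalar_measureE//.
rewrite [X in X @ _ --> _](_ : _ = (fun n =>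
    (complex.Re (inner (\sum_(k < n) P (F k) x) x))%:E)); last first.
  apply/funext => n.
  rewrite (big_morph (inner ^~ x) (id1 := 0) (op1 := +%R)) ?linear0l//;
    last by move=> u v; rewrite linearDl.
  rewrite Re_sum -sumEFin big_mkord.
  by apply: eq_bigr => k _; rewrite scalar_measureE.
apply: cvg_EFin; first exact: nearW.
by apply: Re_inner_cvg; exact: pvm_sigma_additive.
Qed.

HB.instance Definition _ := isMeasure.Build _ _ _ scalar_measure
  scalar_measure0 scalar_measure_ge0 scalar_measure_sigma_additive.

End scalar_measure.

Definition absolutely_continuous_on (R : realType) (a b : R) (F : R -> R) :=
  forall eps : R, 0 < eps -> exists2 delta : R, 0 < delta &
    forall n (u v : 'I_n -> R),
      (forall i, [/\ a <= u i, u i <= v i & v i <= b]) ->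
      trivIset setT (fun i => `]u i, v i[%classic) ->
      \sum_(i < n) (v i - u i) < delta ->
      \sum_(i < n) `|F (v i) - F (u i)| < eps.

Definition Lp_on (R : realType) (p a b : R) : set (R -> R) :=
  [set f | f \_ `[a, b] \in Lfun lebesgue_measure p%:E].

Section spectral.
Context {R : realType} {H : hilbertType R}.
Implicit Types (A : operator H) (P : pvm H).

(* [A] is the integral of the identity against [P]; by polarization, the
   domain and the quadratic form determine the operator. *)
Definition is_spectral_measure A P :=
  dom A = [set x | (\int[scalar_measure P x]_l (l ^+ 2)%:E < +oo)%E] /\
  forall x, dom A x ->
    inner (A x) x = (\int[scalar_measure P x]_l l)%:C.

(* The value of a spectral family at an eigenvalue [l] is a convention: the
   spectral projection of [`]-oo, l]] or that of [`]-oo, l[]. On an interval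
   [a, b] both endpoint values are taken here as the limits from inside it:
   the family is right-continuous up to [b] and left-continuous from [b] on. It
   agrees on [a, b] with the right-continuous family unless [b] is an eigenvalue,
   and with the left-continuous one at every point of [a, b] that is not an
   eigenvalue. Absolute continuity on [a, b] is then that of the spectral
   measure on the open interval.
   Under either one-sided convention used throughout, absolute continuity on
   [a, b] is lost in the limit: on L^2([a, b]) (+) C, the operators t (+) (b + 1/n)
   tend in norm to t (+) b, whose right-continuous family jumps at [b], and the
   operators t (+) (a - 1/n) to t (+) a, whose left-continuous family jumps
   from [a] to the points on its right. *)
Definition resolution (b : R) P (l : R) : H -> H :=
  if l < b then P `]-oo, l]%classic else P `]-oo, l[%classic.

Definition spectral_function (b : R) P (e : H) (l : R) : R :=
  complex.Re (inner (resolution b P l e) e).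

Definition ac_spectrum_on (a b : R) P :=
  forall e, absolutely_continuous_on a b (spectral_function b P e).

Definition purely_ac_spectrum_on (a b : R) A P :=
  (forall l, a <= l <= b -> spectrum A l%:C) /\ ac_spectrum_on a b P.

(* [P] is the spectral measure of an operator with simple spectrum. *)
Definition generating_vector P (e : H) :=
  closure (linear_span [set P [set` I] e | I in [set: interval R]]) = setT.

End spectral.

(* Main.v *)
Require Import Defs.
From HB Require Import structures.
From mathcomp Require Import all_boot all_order all_algebra.
From mathcomp Require Import ring lra.
From mathcomp Require Import sesquilinear complex.
From mathcomp Require Import all_classical all_reals all_analysis.
From mathcomp Require Import measurable_realfun.

Set Implicit Arguments.
Unset Strict Implicit.
Unset Printing Implicit Defensive.

Import Order.TTheory GRing.Theory Num.Theory.
Import numFieldNormedType.Exports.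

Local Open Scope classical_set_scope.
Local Open Scope ring_scope.

(** The spectral functions converge because the spectral projections do. Let
    [I] be a bounded interval and [B] a half-line at positive distance from it.
      If [x]
    is in the range of [P I] then [P_ n B x] tends to 0: choose a point [c] with
    [I] within distance [r] of [c] and [B] at distance at least [d > r] from
    [c], on one side. On the range of [P_ n B] the operator [A_ n - c] is
    bounded below by [d], and it commutes with [P_ n B]; as the graphs of the
    [A_ n] converge to that of [A], the limit superior of [|P_ n B x|] is at
    most [1 / d] times the one for [(A - c) x], a vector which is again in the
    range of [P I], of norm at most [r |x|] ([sub_scalar_ge], [sub_scalar_le]).
    Iteration bounds it by [(r / d) ^+ k |x|] for all [k] ([separated_iter]).
    All that the argument uses of the spectral theorem is read off the quadratic
    form: it has no cross terms between complementary spectral subspaces, so [A]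
    commutes with the projections ([app_pvm]).

    Splitting [e0] at a point then compares the two distribution functions at
    separated points: for [s < t], asymptotically, [F_n s <= F t] and
    [F s <= F_n t] ([limit_le], [limit_ge]). Increments of [F_n] over intervals
    of [[a, b]] lie between [C] times the length and the integral of [g]. Both
    bounds pass to [F] on intervals inside [[a, b]]. The lower one makes the
    spectral projections of all such intervals nonzero, so that every point of
    [[a, b]] is in the spectrum ([spectrum_of_support]). The upper one, known on
    half-open intervals, holds on all Borel sets ([le_measure_ocitv]), and the
    Radon-Nikodym density [f] of the spectral measure on [`]a, b[] satisfies
    [0 <= f <= |g|] ([bounded_density]); hence [f] is in [L^p]. Since [e0]
    generates, a Lebesgue null subset of [`]a, b[] has a vanishing spectral
    projection ([generating_vector_eq0]), and the scalar spectral measures of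
    all vectors are absolutely continuous there. Finally [F] has no atoms in
    [`]a, b[], which upgrades the comparison of [F_n] and [F] to convergence at
    interior points; the integral of [|g|] is a modulus of continuity common to
    all the functions and their limit, so the convergence is uniform up to the
    endpoints. *)

(** * The underlying real inner product space *)
Section real_inner.
Local Open Scope complex_scope.
Context {R : realType} {H : hilbertType R}.
Implicit Types (x y z : H) (r : R).

(** The Hilbert space is used through its real inner product only: spectral
    projections and symmetric operators are symmetric for it, and polarization
    needs no complex scalars. *)
Definition rinner x y : R := complex.Re (inner x y).

(** The norm of [H] has values in [R[i]]; this is the same number in [R]. *)
Definition hnorm x : R := complex.Re `|x|.

Lemma hnormE x : `|x| = (hnorm x)%:C.
Proof. by rewrite /hnorm RRe_real// realE normr_ge0. Qed.

Lemma hnorm_ge0 x : 0 <= hnorm x.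
Proof. by rewrite -lecR -hnormE normr_ge0. Qed.

Lemma sqr_hnorm x : hnorm x ^+ 2 = rinner x x.
Proof. by rewrite /rinner -normr_inner hnormE -rmorphXn. Qed.

Lemma hnorm0 : hnorm 0 = 0. Proof. by rewrite /hnorm normr0. Qed.

Lemma hnorm0_eq0 x : hnorm x = 0 -> x = 0.
Proof. by move=> x0; apply/eqP; rewrite -normr_eq0 hnormE x0. Qed.

Lemma ler_hnormD x y : hnorm (x + y) <= hnorm x + hnorm y.
Proof. by rewrite -lecR rmorphD/= -!hnormE ler_normD. Qed.

Lemma hnormN x : hnorm (- x) = hnorm x. Proof. by rewrite /hnorm normrN. Qed.

Lemma hnormB x y : hnorm (x - y) = hnorm (y - x). Proof.
  by rewrite /hnorm distrC. Qed.

Lemma hnormZ r x : hnorm (r%:C *: x) = `|r| * hnorm x.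
Proof.
have normC_real : `|r%:C| = `|r|%:C :> R[i].
  by rewrite normc_def/= expr0n addr0 sqrtr_sqr.
by rewrite /hnorm normrZ normC_real (hnormE x) -rmorphM.
Qed.

Lemma rinnerC x y : rinner x y = rinner y x.
Proof.
have Re_conj (c : R[i]) : complex.Re (Num.conj c) = complex.Re c by case: c.
by rewrite /rinner hermC expr0 mul1r Re_conj.
Qed.

Lemma rinnerDl x y z : rinner (x + y) z = rinner x z + rinner y z.
Proof. by rewrite /rinner linearDl ReD. Qed.

Lemma rinnerDr x y z : rinner z (x + y) = rinner z x + rinner z y.
Proof. by rewrite /rinner linearDr ReD. Qed.

Lemma rinnerNl x z : rinner (- x) z = - rinner x z.
Proof. by apply: (addIr (rinner x z));
  rewrite -rinnerDl !addNr /rinner linear0l. Qed.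

Lemma rinnerNr x z : rinner z (- x) = - rinner z x.
Proof. by rewrite rinnerC rinnerNl rinnerC. Qed.

Lemma ReZ r (c : R[i]) : complex.Re (r%:C * c) = r * complex.Re c.
Proof. by case: c => u v /=; rewrite mul0r subr0. Qed.

Lemma rinnerZl r x z : rinner (r%:C *: x) z = r * rinner x z.
Proof. by rewrite /rinner linearZl_LR/= ReZ. Qed.

Lemma rinnerZr r x z : rinner z (r%:C *: x) = r * rinner z x.
Proof. by rewrite rinnerC rinnerZl rinnerC. Qed.

Lemma rinner_le x y : `|rinner x y| <= hnorm x * hnorm y.
Proof.
rewrite -lecR rmorphM/= -!hnormE; apply: le_trans (inner_CauchySchwarz x y).
exact: normc_ge_Re.
Qed.

Lemma sqr_hnormD x y : hnorm (x + y) ^+ 2 =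
  hnorm x ^+ 2 + hnorm y ^+ 2 + 2 * rinner x y.
Proof. rewrite !sqr_hnorm !rinnerDl !rinnerDr (rinnerC y x); ring. Qed.

(** If [x] were nonzero, some [y] in [D] would be closer to [x] than [|x|], and
    [|x|^2 = (x, x - y)] would be less than [|x|^2]. *)
Lemma rinner_dense (D : set H) x : dense D ->
  (forall y, D y -> rinner x y = 0) -> x = 0.
Proof.
move=> dD xD; apply: hnorm0_eq0; apply/eqP; apply/negPn/negP => x0.
have x0' : 0 < hnorm x by rewrite lt0r x0 hnorm_ge0.
have [|y [xy Dy]] := dD (ball x ((hnorm x)%:C)) _ (ball_open _ _).
  by exists x; apply: ballxx; rewrite ltcR.
rewrite -ball_normE/= hnormE ltcR in xy.
have := rinner_le x (x - y);
  rewrite rinnerDr rinnerNr (xD y Dy) subr0 -sqr_hnorm.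
rewrite ger0_norm ?sqr_ge0// expr2 ler_pM2l//; lra.
Qed.
End real_inner.

(** * Algebra of projection-valued measures *)
Section pvm_algebra.
Local Open Scope complex_scope.
Context {R : realType} {H : hilbertType R} (P : pvm H).
Implicit Types (x y z : H) (A B : set R).

Lemma pvm_lin B r x y : measurable B -> P B (r *: x + y) = r *: P B x + P B y.
Proof. by move=> mB; have [PL _ _] := pvm_proj P mB; rewrite PL. Qed.

Lemma pvmD B x y : measurable B -> P B (x + y) = P B x + P B y.
Proof. by move=> mB; have := pvm_lin 1 x y mB; rewrite !scale1r. Qed.

Lemma pvmx0 B : measurable B -> P B 0 = 0.
Proof. by move=> mB; have := pvmD 0 0 mB;
  rewrite addr0 -{1}[P B 0]addr0 => /addrI. Qed.

Lemma pvmZ B r x : measurable B -> P B (r *: x) = r *: P B x.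
Proof. by move=> mB; have := pvm_lin r x 0 mB;
  rewrite !addr0 pvmx0// addr0. Qed.

Lemma pvmN B x : measurable B -> P B (- x) = - P B x.
Proof. by move=> mB; rewrite -scaleN1r pvmZ// scaleN1r. Qed.

Lemma pvmB B x y : measurable B -> P B (x - y) = P B x - P B y.
Proof. by move=> mB; rewrite pvmD// pvmN. Qed.

Lemma pvmK B x : measurable B -> P B (P B x) = P B x.
Proof. by move=> mB; have [_ PK _] := pvm_proj P mB; rewrite PK. Qed.

Lemma pvm_rinner B x y : measurable B -> rinner (P B x) y = rinner x (P B y).
Proof. by move=> mB; have [_ _ PC] := pvm_proj P mB; rewrite /rinner PC. Qed.

Lemma sqr_hnorm_pvm B x : measurable B -> hnorm (P B x) ^+ 2 = rinner (P B x) x.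
Proof. by move=> mB; rewrite sqr_hnorm pvm_rinner// pvmK// -pvm_rinner. Qed.

Lemma pvmU A B x : measurable A -> measurable B -> A `&` B = set0 ->
  P (A `|` B) x = P A x + P B x.
Proof.
move=> mA mB AB0.
have := @pvm_sigma_additive _ _ P (bigcup2 A B).
move=> /(_ _ _ x); rewrite bigcup2E.
have mAB k : measurable (bigcup2 A B k).
  by case: k => [|[|k]]//=; exact: measurable0.
move=> /(_ mAB); have tAB : trivIset setT (bigcup2 A B).
  by rewrite -trivIset_bigcup2.
move=> /(_ tAB) cv; symmetry; apply: (cvg_unique _ _ cv);
  first exact: norm_hausdorff.
apply: cvg_near_cst; exists 2%N => // n /= n2; apply/esym.
rewrite -(subnKC n2) big_split_ord/= big_ord_recl big_ord1/= big1 ?addr0//.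
by move=> i _; rewrite pvm0.
Qed.

Lemma pvmC B x : measurable B -> P (~` B) x = x - P B x.
Proof.
move=> mB; apply/eqP; rewrite eq_sym subr_eq eq_sym -[X in _ == X](@pvmT _ _ P).
rewrite -(setvU B) pvmU//; first exact: measurableC.
by rewrite setICl.
Qed.

Lemma sqr_hnorm_pvmC B x : measurable B ->
  hnorm x ^+ 2 = hnorm (P B x) ^+ 2 + hnorm (P (~` B) x) ^+ 2.
Proof.
move=> mB; rewrite !sqr_hnorm_pvm//; last exact: measurableC.
by rewrite -rinnerDl pvmC// addrC subrK sqr_hnorm.
Qed.

Lemma hnorm_pvm_le B x : measurable B -> hnorm (P B x) <= hnorm x.
Proof.
move=> mB; rewrite -(@ler_pXn2r _ 2) ?nnegrE ?hnorm_ge0//.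
by rewrite (sqr_hnorm_pvmC x mB) lerDl sqr_ge0.
Qed.

(** The projection on [A `|` B] does not increase norms, and the square of its
    norm is [|P A z|^2 + |P B z|^2]; for [z] in the range of [P B] the second
    term alone is already [|z|^2]. *)
Lemma pvm_disjoint A B x : measurable A -> measurable B -> A `&` B = set0 ->
  P A (P B x) = 0.
Proof.
move=> mA mB AB0; apply: hnorm0_eq0; apply/eqP; rewrite -sqrf_eq0.
rewrite eq_le sqr_ge0 andbT.
have := hnorm_pvm_le (P B x) (measurableU _ _ mA mB).
rewrite -(@ler_pXn2r _ 2) ?nnegrE ?hnorm_ge0// [leLHS]sqr_hnorm_pvm ?pvmU//;
  last exact: measurableU.
by rewrite rinnerDl -!sqr_hnorm_pvm// pvmK// gerDr.
Qed.

(** Additivity alone makes a projection-valued measure multiplicative, as it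
    makes the projections of disjoint sets orthogonal. *)
Lemma pvmI A B x : measurable A -> measurable B -> P A (P B x) = P (A `&` B) x.
Proof.
move=> mA mB.
have mAB := measurableI _ _ mA mB.
rewrite -[in LHS](setUIDK B A) pvmU//; last 3 first.
- exact: measurableI.
- exact: measurableD.
- by rewrite -setIA setDIK setI0.
rewrite pvmD// [X in _ + X]pvm_disjoint ?addr0//; last 2 first.
- exact: measurableD.
- exact: setDIK.
rewrite setIC; have := pvmC (P (A `&` B) x) mA; rewrite pvm_disjoint//;
  last 2 first.
- exact: measurableC.
- by rewrite setIA setICl set0I.
by move=> /esym/subr0_eq <-.
Qed.

End pvm_algebra.

(** * Scalar spectral measures *)
Section scalar_measure_theory.
Local Open Scope complex_scope.
Context {R : realType} {H : hilbertType R} (P : pvm H).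
Implicit Types (x y z : H) (A B : set R).

Lemma scalar_measure_hnorm x B : scalar_measure P x B = (hnorm (P B x) ^+ 2)%:E.
Proof. by rewrite /scalar_measure hnormE -rmorphXn. Qed.

Let scalar_measure_fin x : fin_num_fun (scalar_measure P x).
Proof. by move=> B mB. Qed.

HB.instance Definition _ x := Measure_isFinite.Build _ _ _ (scalar_measure P x)
  (@scalar_measure_fin x).

Lemma scalar_measure_pvm x A B : measurable A -> measurable B ->
  scalar_measure P (P B x) A = scalar_measure P x (A `&` B).
Proof. by move=> mA mB; rewrite !scalar_measure_hnorm pvmI. Qed.

(** This is what splits the quadratic form of an operator along [B] and its
    complement. *)
Lemma integral_scalar_measure_pvm x B (f : R -> \bar R) : measurable B ->
  measurable_fun [set: R] f ->
  (\int[scalar_measure P (P B x)]_l f l =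
    \int[scalar_measure P x]_(l in B) f l)%E.
Proof.
move=> mB mf.
have mBC : measurable (~` B) by exact: measurableC.
rewrite -(setvU B) setUC integral_setU//; last 2 first.
- by rewrite setUv.
- by rewrite disj_set2E setICr.
rewrite (eq_measure_integral (scalar_measure P x)); last first.
  by move=> A0 mA AB; rewrite [LHS]scalar_measure_pvm// setIidl.
rewrite [X in (_ + X)%E](_ : _ = 0)%E ?adde0//.
apply: null_set_integral => //; first exact: measurable_funTS.
by rewrite [LHS]scalar_measure_pvm// setICl measure0.
Qed.

End scalar_measure_theory.

(** * A self-adjoint operator and its spectral projections *)
Section spectral_operator.
Local Open Scope complex_scope.
Context {R : realType} {H : hilbertType R} (A : operator H) (P : pvm H).
Hypothesis saA : self_adjoint A.
Hypothesis AP : is_spectral_measure A P.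
Implicit Types (x y z : H) (B : set R).

Let mid : measurable_fun setT (fun l : R => l%:E).
Proof. exact/measurable_EFinP. Qed.

Let msqr : measurable_fun setT (fun l : R => (l ^+ 2)%:E).
Proof. exact/measurable_EFinP/measurable_funX. Qed.

Lemma domD x y : dom A x -> dom A y -> dom A (x + y).
Proof. by move=> Ax Ay; rewrite -[x]scale1r; exact: dom_lin. Qed.

Lemma domZ c x : dom A x -> dom A (c *: x).
Proof. by move=> Ax; rewrite -[_ *: _]addr0; apply: dom_lin => //;
  exact: dom0. Qed.

Lemma appD x y : dom A x -> dom A y -> A (x + y) = A x + A y.
Proof. by move=> Ax Ay; rewrite -[x]scale1r app_lin// !scale1r. Qed.

Lemma app0 : A 0 = 0.
Proof. by have := appD (dom0 A) (dom0 A);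
  rewrite addr0 -{1}[A 0]addr0 => /addrI. Qed.

Lemma appZ c x : dom A x -> A (c *: x) = c *: A x.
Proof. by move=> Ax; have := app_lin c Ax (dom0 A); rewrite app0 !addr0. Qed.

Lemma appB x y : dom A x -> dom A y -> A (x - y) = A x - A y.
Proof.
move=> Ax Ay; rewrite -scaleN1r appD//; last exact: domZ.
by rewrite appZ// scaleN1r.
Qed.

Lemma rinner_app x y : dom A x -> dom A y -> rinner (A x) y = rinner x (A y).
Proof.
move=> Ax Ay; have [_ AE] := saA.
have : adjoint_graph A (y, A y) by rewrite AE; exists y.
by move=> /(_ x Ax); rewrite /rinner/= => ->.
Qed.

Lemma dom_pvm B x : measurable B -> dom A x -> dom A (P B x).
Proof.
move=> mB; have [-> _]/= := AP; apply: le_lt_trans.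
rewrite integral_scalar_measure_pvm//; apply: ge0_subset_integral => //.
by move=> l _; rewrite lee_fin sqr_ge0.
Qed.

(** [|l| <= 1 + l^2], and scalar spectral measures are finite. *)
Lemma dom_integrable x : dom A x ->
  (scalar_measure P x).-integrable setT (fun l => l%:E).
Proof.
move=> Ax; apply/integrableP; split => //.
have [domE _] := AP; move: Ax; rewrite domE/= => Ax.
apply: (@le_lt_trans _ _
  (\int[scalar_measure P x]_l ((1 : R)%:E + (l ^+ 2)%:E))%E).
  apply: ge0_le_integral => //.
  - exact: measurableT_comp.
  - by apply: emeasurable_funD.
  - move=> l _; rewrite /= -EFinD lee_fin.
    have := sqr_ge0 (`|l| - 1); rewrite sqrrB1 real_normK ?num_real//;
      have := sqr_ge0 l; lra.
rewrite ge0_integralD//; last first.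
  by move=> l _; rewrite lee_fin sqr_ge0.
rewrite lte_add_pinfty// integral_cst// mul1e.
exact: fin_num_fun_lty.
Qed.

Lemma rinner_form x : dom A x ->
  (rinner (A x) x)%:E = (\int[scalar_measure P x]_l l%:E)%E.
Proof.
move=> Ax; have [_ /(_ _ Ax)] := AP; rewrite /rinner => -> /=.
by rewrite /Rintegral fineK//; exact: integrable_fin_num (dom_integrable Ax).
Qed.

(** The form at [x] is an integral over the line; its restrictions to [B] and to
    the complement are the forms at the two components of [x], so there is no
    cross term. *)
Lemma rinner_form_pvm B x : measurable B -> dom A x ->
  rinner (A x) x = rinner (A (P B x)) (P B x) + rinner (A (P (~` B) x))
    (P (~` B) x).
Proof.
move=> mB Ax; apply: EFin_inj; have mBC := measurableC mB.
rewrite EFinD !rinner_form//; try exact: dom_pvm.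
rewrite !integral_scalar_measure_pvm// -integral_setU ?setUv//.
by rewrite disj_set2E setICr.
Qed.

(** The absence of cross terms in the form says that [A y] is orthogonal to all
    [P (~` C) z] when [y] is in the range of [P C] and [z] in the domain. By
    density of the domain [A y] is in the range of [P C] as well; applied to [B]
    and to its complement, this is commutation. *)
Lemma app_pvm B x : measurable B -> dom A x -> A (P B x) = P B (A x).
Proof.
move=> mB Ax; have mBC := measurableC mB.
have cross y z C : measurable C -> dom A y -> dom A z ->
    rinner (A (P C y)) (P (~` C) z) = 0.
  move=> mC Ay Az; have mCC := measurableC mC.
  have dC := dom_pvm mC Ay; have dCC := dom_pvm mCC Az.
  have := rinner_form_pvm mC (domD dC dCC).
  rewrite !pvmD// !pvmK// [P C (P _ z)]pvm_disjoint ?setICr//.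
  rewrite [P (~` C) (P _ y)]pvm_disjoint ?setICl// addr0 add0r.
  rewrite appD// rinnerDl !rinnerDr (rinner_app dCC dC)
    (rinnerC _ (A (P C y))); lra.
have cross0 y C : measurable C -> dom A y -> P (~` C) (A (P C y)) = 0.
  move=> mC Ay; have [dA _] := saA; apply: (rinner_dense dA) => z Az.
  by rewrite pvm_rinner; [exact: cross|exact: measurableC].
have E1 : P B (A (P B x)) = A (P B x).
  by have /eqP := cross0 x B mB Ax; rewrite pvmC// subr_eq0 => /eqP.
have E2 : P B (A (P (~` B) x)) = 0.
  by have := cross0 x _ mBC Ax; rewrite setCK.
have {2}-> : x = P B x + P (~` B) x by rewrite pvmC// addrC subrK.
rewrite appD; [|exact: dom_pvm|exact: dom_pvm].
by rewrite pvmD// E1 E2 addr0.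
Qed.

Lemma rinner_form_ge B m x : measurable B -> dom A x -> P B x = x ->
  (forall l, B l -> m <= l) -> m * hnorm x ^+ 2 <= rinner (A x) x.
Proof.
move=> mB Ax Bx mBl; rewrite -lee_fin rinner_form// -[in leRHS]Bx.
rewrite integral_scalar_measure_pvm//.
have -> : (m * hnorm x ^+ 2)%:E = (\int[scalar_measure P x]_(l in B) m%:E)%E.
  by rewrite integral_cst//= scalar_measure_hnorm Bx EFinM.
apply: le_integral => //; last by move=> l /[!inE] Bl; rewrite lee_fin mBl.
  exact: finite_measure_integrable_cst.
by apply: integrableS (dom_integrable Ax).
Qed.

Lemma rinner_form_le B m x : measurable B -> dom A x -> P B x = x ->
  (forall l, B l -> l <= m) -> rinner (A x) x <= m * hnorm x ^+ 2.
Proof.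
move=> mB Ax Bx mBl; rewrite -lee_fin rinner_form// -[in leLHS]Bx.
rewrite integral_scalar_measure_pvm//.
have -> : (m * hnorm x ^+ 2)%:E = (\int[scalar_measure P x]_(l in B) m%:E)%E.
  by rewrite integral_cst//= scalar_measure_hnorm Bx EFinM.
apply: le_integral => //; last by move=> l /[!inE] Bl; rewrite lee_fin mBl.
  by apply: integrableS (dom_integrable Ax).
exact: finite_measure_integrable_cst.
Qed.

Lemma dom_pvm_bounded B K x : measurable B -> (forall l, B l -> `|l| <= K) ->
  P B x = x -> dom A x.
Proof.
move=> mB BK Bx; have [-> _]/= := AP; rewrite -Bx.
rewrite integral_scalar_measure_pvm//.
apply: (@le_lt_trans _ _ (\int[scalar_measure P x]_(l in B) (K ^+ 2)%:E)%E).
  apply: ge0_le_integral => //.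
  - by move=> l _; rewrite lee_fin sqr_ge0.
  - exact: measurable_funTS.
  - by move=> l Bl; rewrite lee_fin -(real_normK (num_real l)) lerXn2r ?nnegrE
    ?(le_trans _ (BK _ Bl)) ?BK.
by rewrite integral_cst//= scalar_measure_hnorm -EFinM ltry.
Qed.

Lemma dom_pvm_near B c r x : measurable B -> (forall l, B l -> `|l - c| <= r) ->
  P B x = x -> dom A x.
Proof.
move=> mB Br; apply: (dom_pvm_bounded (K := `|c| + r)) => // l /Br lr.
rewrite -[l](subrK c) addrC; apply: le_trans (ler_normD _ _) _.
by rewrite lerD2l.
Qed.

End spectral_operator.

(** * Norm bounds on spectral subspaces *)
Section spectral_bounds.
Local Open Scope complex_scope.
Context {R : realType} {H : hilbertType R} (A : operator H) (P : pvm H).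
Hypothesis saA : self_adjoint A.
Hypothesis AP : is_spectral_measure A P.
Implicit Types (x y z : H) (B : set R) (c r d : R).

(** The operator [A - c], on the domain of [A]. *)
Definition sub_scalar c x := A x - c%:C *: x.

Lemma sub_scalar_pvm B c x : measurable B -> dom A x ->
  sub_scalar c (P B x) = P B (sub_scalar c x).
Proof. by move=> mB Ax; rewrite /sub_scalar pvmB// pvmZ// (app_pvm saA AP). Qed.

Lemma sub_scalar_id B c x : measurable B -> dom A x -> P B x = x ->
  P B (sub_scalar c x) = sub_scalar c x.
Proof. by move=> mB Ax Bx; rewrite -sub_scalar_pvm// Bx. Qed.

Lemma rinner_sub_scalar c x : rinner (sub_scalar c x) x =
  rinner (A x) x - c * hnorm x ^+ 2.
Proof. by rewrite /sub_scalar rinnerDl rinnerNl rinnerZl sqr_hnorm. Qed.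

(** As [B] lies on one side of [c], the form of [A - c] or its opposite is at
    least [d |x|^2] on the range of [P B]; then Cauchy-Schwarz. *)
Lemma sub_scalar_ge B c d x : measurable B -> dom A x -> P B x = x ->
  (forall l, B l -> d <= l - c) \/ (forall l, B l -> d <= c - l) ->
  d * hnorm x <= hnorm (sub_scalar c x).
Proof.
move=> mB Ax Bx dB.
have {dB} : d * hnorm x ^+ 2 <= `|rinner (sub_scalar c x) x|.
  case: dB => dB.
    apply: le_trans (ler_norm _); rewrite rinner_sub_scalar lerBrDr -mulrDl.
    by apply: (rinner_form_ge AP mB) => // l /dB; rewrite lerBrDr.
  rewrite -normrN; apply: le_trans (ler_norm _).
  rewrite rinner_sub_scalar opprB lerBrDr addrC -lerBrDr -mulrBl.
  by apply: (rinner_form_le AP mB) => // l /dB; lra.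
have [->|x0] := eqVneq (hnorm x) 0; first by rewrite mulr0 hnorm_ge0.
move=> /le_trans/(_ (rinner_le _ _)); rewrite expr2 mulrA ler_pM2r//.
by rewrite lt0r x0 hnorm_ge0.
Qed.

(** The form of [A - c] is at most [r |x|^2] in absolute value on the range of
    [P B], which [A - c] maps to itself. For a symmetric operator, polarization
    turns a bound of the form into a bound of the norm. *)
Lemma sub_scalar_le B c r x : measurable B -> P B x = x ->
  (forall l, B l -> `|l - c| <= r) -> hnorm (sub_scalar c x) <= r * hnorm x.
Proof.
move=> mB Bx Br.
have dB z : P B z = z -> dom A z by exact: (dom_pvm_near AP mB Br).
have form z : P B z = z -> `|rinner (sub_scalar c z) z| <= r * hnorm z ^+ 2.
  move=> Bz; rewrite rinner_sub_scalar ler_norml; apply/andP; split.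
    rewrite lerBrDr -mulNr -mulrDl;
      apply: (rinner_form_ge AP mB (dB _ Bz) Bz) => l /Br.
    by rewrite ler_norml => /andP[]; lra.
  rewrite lerBlDr -mulrDl; apply: (rinner_form_le AP mB (dB _ Bz) Bz) => l /Br.
  by rewrite ler_norml => /andP[]; lra.
set y := sub_scalar c x; have By : P B y = y by apply: sub_scalar_id => //;
  exact: dB.
have [y0|y0] := eqVneq (hnorm y) 0.
  rewrite y0; have [->|x0] := eqVneq (hnorm x) 0; first by rewrite mulr0.
  have := le_trans (normr_ge0 _) (form x Bx).
  by rewrite !pmulr_lge0 ?exprn_gt0// lt0r x0 hnorm_ge0.
have y0' : 0 < hnorm y by rewrite lt0r y0 hnorm_ge0.
have [x0|x0] := eqVneq (hnorm x) 0.
  move: y0'; rewrite /y (hnorm0_eq0 x0) /sub_scalar app0 scaler0 subr0.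
  by rewrite hnorm0 mulr0 lexx.
have x0' : 0 < hnorm x by rewrite lt0r x0 hnorm_ge0.
(* [z] is as long as [x], so the parallelogram law for [x + z] and [x - z] gives
   [4 |x| |y| <= 4 r |x|^2]. *)
set s := hnorm x / hnorm y; set z := s%:C *: y.
have Bz : P B z = z by rewrite pvmZ// By.
have dx := dB _ Bx; have dy := dB _ By; have dz := dB _ Bz.
have sD : sub_scalar c (x + z) = y + sub_scalar c z.
  by rewrite /y /sub_scalar appD// scalerDr opprD addrACA.
have sB : sub_scalar c (x - z) = y - sub_scalar c z.
  by rewrite /y /sub_scalar appB// scalerBr !opprD !opprK addrACA.
have sym : rinner (sub_scalar c z) x = rinner y z.
  rewrite /y /sub_scalar !rinnerDl !rinnerNl (rinnerZl c z) (rinnerZl c x)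
    (rinner_app saA dz dx) (rinnerC z x).
  by rewrite (rinnerC z (A x)).
have nz : hnorm z ^+ 2 = hnorm x ^+ 2.
  by rewrite /z hnormZ /s ger0_norm ?divr_ge0 ?hnorm_ge0// divfK.
have yz : rinner y z = hnorm x * hnorm y.
  by rewrite /z rinnerZr -sqr_hnorm /s; field.
have := form (x + z); rewrite pvmD// Bx Bz sD => /(_ erefl).
have := form (x - z); rewrite pvmB// Bx Bz sB => /(_ erefl).
clearbody y z s.
rewrite !sqr_hnormD hnormN rinnerNr nz (rinnerDl y (sub_scalar c z))
  (rinnerDl y (- sub_scalar c z)).
rewrite !rinnerDr !(rinnerNl (sub_scalar c z)) !rinnerNr sym yz.
rewrite !ler_norml => /andP[h1 h2] /andP[h3 h4].
have : hnorm x * hnorm y <= hnorm x * (r * hnorm x) by lra.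
by rewrite ler_pM2l.
Qed.

End spectral_bounds.
Arguments sub_scalar {R H} A c x.

(** * Spectral projections of half-lines receding to infinity *)
Section pvm_tails.
Local Open Scope complex_scope.
Context {R : realType} {H : hilbertType R} (P : pvm H).
Implicit Types (x : H).

Lemma pvm_cvg0 x (F : nat -> set R) : (forall k, measurable (F k)) ->
  nonincreasing_seq F -> \bigcap_k F k = set0 ->
  forall e, 0 < e -> \forall k \near \oo, hnorm (P (F k) x) < e.
Proof.
move=> mF ndF F0 e e0.
have := @nonincreasing_cvg_mu _ _ _ (scalar_measure P x) F.
rewrite -ge0_fin_numE// fin_num_measure// F0 measure0 =>
  /(_ isT mF measurable0 ndF).
move=> /fine_cvgP[_ /cvgrPdist_lt/(_ _ (exprn_gt0 2 e0))].
apply: filterS => k; rewrite sub0r normrN /= hnormE -rmorphXn/=.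
rewrite ger0_norm ?sqr_ge0//.
by rewrite ltr_pXn2r// nnegrE ?hnorm_ge0// ltW.
Qed.

Lemma pvm_tail_right x e : 0 < e ->
  \forall k \near \oo, hnorm (P `]k%:R, +oo[%classic x) < e.
Proof.
apply: pvm_cvg0 => // [m n mn|].
  by apply/subsetPset => l/=; rewrite !in_itv/= !andbT; apply: le_lt_trans;
    rewrite ler_nat.
rewrite -subset0 => l /= /(_ (Num.truncn l).+1 Logic.I)/=.
by rewrite in_itv/= andbT; apply/negP;
  rewrite -leNgt ltW// real_truncnS_gt ?num_real.
Qed.

Lemma pvm_tail_left x e : 0 < e ->
  \forall k \near \oo, hnorm (P `]-oo, - k%:R]%classic x) < e.
Proof.
apply: pvm_cvg0 => // [m n mn|].
  by apply/subsetPset => l/=; rewrite !in_itv/= => /le_trans; apply;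
    rewrite lerN2 ler_nat.
rewrite -subset0 => l /= /(_ (Num.truncn (- l)).+1 Logic.I)/=.
by rewrite in_itv/=; apply/negP; rewrite -ltNge ltrNl real_truncnS_gt ?num_real.
Qed.

End pvm_tails.

(** * Spectral projections and strong convergence of operators *)
Section graph_convergence.
Local Open Scope complex_scope.
Context {R : realType} {H : hilbertType R}.
Variables (A_ : nat -> operator H) (P_ : nat -> pvm H).
Variables (A : operator H) (P : pvm H) (Phi : set H).
Hypothesis saA_ : forall n, self_adjoint (A_ n).
Hypothesis AP_ : forall n, is_spectral_measure (A_ n) (P_ n).
Hypothesis saA : self_adjoint A.
Hypothesis AP : is_spectral_measure A P.
Hypothesis PhiA : forall n, Phi `<=` dom (A_ n).
Hypothesis cvgA : forall e, Phi e -> cvg (A_ n e @[n --> \oo]).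
Hypothesis graphA : graph A = closure (limit_graph A_ Phi).
Implicit Types (x y : H) (B I : set R) (c r d e s t eta : R).

(** A point of the closure is near a point [(u, lim A_n u)], and [A_n u] is
    eventually near its limit. *)
Lemma near_limit_graph x eta : dom A x -> 0 < eta ->
  exists u, [/\ Phi u, hnorm (x - u) < eta &
    \forall n \near \oo, hnorm (A_ n u - A x) < eta].
Proof.
move=> Ax eta0; have eta20 : 0 < eta / 2 by rewrite divr_gt0.
have : graph A (x, A x) by exists x.
have e0 : (0 : R[i]) < (eta / 2)%:C by rewrite ltcR.
rewrite graphA => /(_ _ (nbhsx_ballx _ _ e0)) [_ [[u Pu <-]]] [/= xu wu].
rewrite -!ball_normE/= !hnormE !ltcR in xu wu.
exists u; split => //; first by apply: lt_trans xu _;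
  rewrite ltr_pdivrMr// ltr_pMr// ltr1n.
have /cvgrPdist_lt/(_ _ e0) := cvgA Pu.
apply: filterS => n; rewrite hnormE ltcR => An; rewrite hnormB in An;
  rewrite hnormB in wu.
rewrite -[A_ n u - A x](subrKA (lim (A_ n u @[n --> \oo]))).
by apply: le_lt_trans (ler_hnormD _ _) _; rewrite [ltRHS](splitr eta) ltrD.
Qed.

(** Let [L x] be the limit superior of [|P_ n B x|]. As [P_ n B] commutes with
    [A_ n - c], which is bounded below by [d] on its range, and as
    [(A_ n - c) u] is eventually near [(A - c) x] for a suitable [u] near [x],
    [L x <= L ((A - c) x) / d]. Now [(A - c) x] is again in the range of [P I]
    and has norm at most [r |x|], so the estimate can be iterated. *)
Lemma separated_iter B I c r d : measurable B -> measurable I -> 0 < d ->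
  0 <= r ->
  (forall l, I l -> `|l - c| <= r) ->
  (forall l, B l -> d <= l - c) \/ (forall l, B l -> d <= c - l) ->
  forall k x e, P I x = x -> 0 < e ->
  \forall n \near \oo, hnorm (P_ n B x) <= (r / d) ^+ k * hnorm x + e.
Proof.
move=> mB mI d0 r0 Ir dB.
have rd0 : 0 <= r / d by rewrite divr_ge0// ltW.
elim=> [|k IH] x e Ix e0.
  apply: nearW => n; rewrite expr0 mul1r.
  by rewrite (le_trans (hnorm_pvm_le _ _ mB))// lerDl ltW.
have Ax : dom A x by exact: (dom_pvm_near AP mI Ir Ix).
set y := sub_scalar A c x.
have Iy : P I y = y by exact: (sub_scalar_id saA AP).
have yx : hnorm y <= r * hnorm x by exact: (sub_scalar_le saA AP mI).
have de0 : 0 < d * e / 2 by rewrite divr_gt0// mulr_gt0.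
(* Replacing [x] by [u] costs at most [eta] in [P_ n B x], and [2 eta + |c| eta]
   in [(A_ n - c) u]; the latter is divided by [d]. *)
set K := 1 + (2 + `|c|) / d.
have K0 : 0 < K.
  by rewrite /K addr_gt0// divr_gt0// addr_gt0_ge0.
set eta := e / 2 / K.
have eta0 : 0 < eta by rewrite divr_gt0// divr_gt0.
have [u [Pu xu Au]] := near_limit_graph Ax eta0.
near=> n.
have Aun : hnorm (A_ n u - A x) < eta by near: n.
have yn : hnorm (P_ n B y) <= (r / d) ^+ k * hnorm y + d * e / 2 by near: n;
  exact: IH.
have du : dom (A_ n) u by exact: PhiA.
have dPu : dom (A_ n) (P_ n B u) by exact: (dom_pvm (AP_ n)).
have h1 : d * hnorm (P_ n B u) <= hnorm (P_ n B y) + (2 + `|c|) * eta.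
  apply: le_trans (sub_scalar_ge (AP_ n) mB dPu (pvmK _ _ mB) dB) _.
  rewrite (sub_scalar_pvm (saA_ n) (AP_ n))//.
  rewrite -[sub_scalar (A_ n) c u](subrK y) addrC pvmD//.
  apply: le_trans (ler_hnormD _ _) _; rewrite lerD2l.
  apply: le_trans (hnorm_pvm_le _ _ mB) _.
  have -> : sub_scalar (A_ n) c u - y = (A_ n u - A x) + c%:C *: (x - u).
    by rewrite /y /sub_scalar scalerBr opprD opprK addrACA
      [- (c%:C *: u) + _]addrC.
  apply: le_trans (ler_hnormD _ _) _; rewrite hnormZ mulrDl.
  rewrite lerD//; first by lra.
  by rewrite ler_wpM2l// ltW.
have h2 : hnorm (P_ n B x) <= hnorm (P_ n B u) + eta.
  rewrite -[x in leLHS](subrK u) addrC pvmD//.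
  apply: le_trans (ler_hnormD _ _) _; rewrite lerD2l.
  by rewrite (le_trans (hnorm_pvm_le _ _ mB))// ltW.
have h3 : (r / d) ^+ k * hnorm y <= (r / d) ^+ k * (r * hnorm x).
  by rewrite ler_wpM2l// exprn_ge0.
have etaE : e / 2 = eta + (2 + `|c|) * eta / d.
  have <- : eta * K = e / 2 by rewrite divfK// gt_eqF.
  by rewrite /K mulrDr mulr1 mulrCA mulrA.
apply: le_trans h2 _; rewrite exprSr -mulrA.
have {}h1 : hnorm (P_ n B u) <=
  ((r / d) ^+ k * (r * hnorm x) + d * e / 2 + (2 + `|c|) * eta) / d.
  by rewrite ler_pdivlMr// mulrC; lra.
have h4 : ((r / d) ^+ k * (r * hnorm x) + d * e / 2 + (2 + `|c|) * eta) / d =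
   (r / d) ^+ k * (r / d * hnorm x) + e / 2 + (2 + `|c|) * eta / d.
  by field; rewrite gt_eqF.
lra.
Unshelve. all: by end_near. Qed.

Lemma separated_cvg0 B I c r d : measurable B -> measurable I -> 0 <= r < d ->
  (forall l, I l -> `|l - c| <= r) ->
  (forall l, B l -> d <= l - c) \/ (forall l, B l -> d <= c - l) ->
  forall x e, P I x = x -> 0 < e -> \forall n \near \oo, hnorm (P_ n B x) < e.
Proof.
move=> mB mI /andP[r0 rd] Ir dB x e Ix e0.
have d0 : 0 < d by exact: le_lt_trans rd.
have : (r / d) ^+ k @[k --> \oo] --> (0 : R).
  by apply: cvg_expr; rewrite ger0_norm ?divr_ge0 ?(ltW d0)// ltr_pdivrMr//
    mul1r.
have e20 : 0 < e / 3 by rewrite divr_gt0.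
have x0 : 0 < hnorm x + 1 by rewrite ltr_wpDl// hnorm_ge0.
move=> /cvgrPdist_lt/(_ _ (divr_gt0 e20 x0))[k _ /(_ k (leqnn k))].
rewrite /= sub0r normrN ger0_norm ?exprn_ge0 ?divr_ge0 ?(ltW d0)//
  ltr_pdivlMr// => hk.
have := separated_iter mB mI d0 r0 Ir dB k Ix e20;
  apply: filterS => n /le_lt_trans; apply.
have : 0 <= (r / d) ^+ k by rewrite exprn_ge0 ?divr_ge0 ?(ltW d0).
lra.
Qed.

(** Cut [`]t, +oo[] down to [`]t, T]] and centre at [c = T]: the distance to [c]
    is at most [T - t] on [`]t, T]] and at least [T - s > T - t] on [`]-oo, s]].
    What is cut off is small uniformly in [n]. *)
Lemma left_right_cvg0 s t x e : s < t -> P `]t, +oo[%classic x = x -> 0 < e ->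
  \forall n \near \oo, hnorm (P_ n `]-oo, s]%classic x) < e.
Proof.
move=> st tx e0; have e20 : 0 < e / 2 by rewrite divr_gt0.
have [k _ /(_ _ (leqnn _)) hk] := pvm_tail_right P x e20.
(* The tail beyond [k] is small; [T] is at least [t] in order to split
   [`]t, +oo[]. *)
pose T := Num.max t k%:R.
have tT : t <= T by rewrite le_max lexx.
have mT : measurable `]t, T]%classic by exact: measurable_itv.
have xT : hnorm (x - P `]t, T]%classic x) < e / 2.
  apply: le_lt_trans hk.
  have -> : x - P `]t, T]%classic x =
    P (`]T, +oo[%classic `&` `]k%:R, +oo[%classic) x.
    rewrite setIidl; last first.
      by apply: subset_itvr; rewrite bnd_simp le_max lexx orbT.
    apply/eqP; rewrite subr_eq -[X in X == _]tx addrC -pvmU//; last first.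
      by rewrite -subset0 => l []/=; rewrite !in_itv/= andbT => /andP[_];
        rewrite leNgt => /negP.
    by rewrite -itv_bndbnd_setU// bnd_simp.
  rewrite -pvmI//; exact: hnorm_pvm_le.
have sep : \forall n \near \oo,
  hnorm (P_ n `]-oo, s]%classic (P `]t, T]%classic x)) < e / 2.
  apply: (@separated_cvg0 _ `]t, T]%classic T (T - t) (T - s)) => //.
  - by rewrite subr_ge0 tT ltrD2l ltrN2.
  - by move=> l/=; rewrite in_itv/= => /andP[tl lT]; rewrite ler0_norm; lra.
  - by right => l/=; rewrite in_itv/= lerD2l lerN2.
  - exact: pvmK.
apply: filterS sep => n close.
rewrite -[x](subrK (P `]t, T]%classic x)) pvmD//.
apply: le_lt_trans (ler_hnormD _ _) _.
have := hnorm_pvm_le (P_ n) (x - P `]t, T]%classic x)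
  (measurable_itv `]-oo, s]).
lra.
Qed.

(** The mirror image of [left_right_cvg0], centred at a far left point. *)
Lemma right_left_cvg0 s t x e : s < t -> P `]-oo, s]%classic x = x -> 0 < e ->
  \forall n \near \oo, hnorm (P_ n `]t, +oo[%classic x) < e.
Proof.
move=> st sx e0; have e20 : 0 < e / 2 by rewrite divr_gt0.
have [k _ /(_ _ (leqnn _)) hk] := pvm_tail_left P x e20.
pose T := Num.min s (- k%:R).
have Ts : T <= s by rewrite ge_min lexx.
have mT : measurable `]T, s]%classic by exact: measurable_itv.
have xT : hnorm (x - P `]T, s]%classic x) < e / 2.
  apply: le_lt_trans hk.
  have -> : x - P `]T, s]%classic x =
    P (`]-oo, T]%classic `&` `]-oo, - k%:R]%classic) x.
    rewrite setIidl; last first.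
      by apply: subset_itvl; rewrite bnd_simp ge_min lexx orbT.
    apply/eqP; rewrite subr_eq -[X in X == _]sx -pvmU//; last first.
      by rewrite -subset0 => l []/=; rewrite !in_itv/= => + /andP[+ _];
        rewrite leNgt => /negP.
    by rewrite -itv_bndbnd_setU// bnd_simp.
  rewrite -pvmI//; exact: hnorm_pvm_le.
have sep : \forall n \near \oo,
  hnorm (P_ n `]t, +oo[%classic (P `]T, s]%classic x)) < e / 2.
  apply: (@separated_cvg0 _ `]T, s]%classic T (s - T) (t - T)) => //.
  - by rewrite subr_ge0 Ts ltrD2r.
  - by move=> l/=; rewrite in_itv/= => /andP[tl lT]; rewrite ger0_norm; lra.
  - by left => l/=; rewrite in_itv/= andbT => tl; rewrite lerD2r ltW.
  - exact: pvmK.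
apply: filterS sep => n close.
rewrite -[x](subrK (P `]T, s]%classic x)) pvmD//.
apply: le_lt_trans (ler_hnormD _ _) _.
have := hnorm_pvm_le (P_ n) (x - P `]T, s]%classic x)
  (measurable_itv `]t, +oo[).
lra.
Qed.

End graph_convergence.

(** * Comparison of measures on the line *)
Section measure_comparison.
Context {R : realType}.
Implicit Types m : {finite_measure set (measurableTypeR R) -> \bar R}.
Local Open Scope ereal_scope.

Let mitv (i : interval R) : @measurable _ (measurableTypeR R) [set` i].
Proof. exact: measurable_itv. Qed.

#[local] Hint Extern 0 (measurable [set` _]) => solve [exact: mitv] : core.

Lemma measure_ocitv_right_cvg0 m (x e : R) : (0 < e)%R ->
  exists2 y, (x < y)%R & m `]x, y]%classic < e%:E.
Proof.
move=> e0; pose F k := `]x, (x + k.+1%:R^-1)%R]%classic.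
have F0 : \bigcap_k F k = set0.
  rewrite -subset0 => y Fy; have xy : (0 < y - x)%R.
    by have := Fy O Logic.I; rewrite /F/= in_itv/= subr_gt0 => /andP[].
  have := Fy (Num.truncn (y - x)^-1) Logic.I; rewrite /F/= in_itv/= => /andP[_].
  apply/negP; rewrite -ltNge -ltrBrDl invf_plt ?posrE//.
  by rewrite real_truncnS_gt// num_real.
have mF k : @measurable _ (measurableTypeR R) (F k) by exact: mitv.
have ndF : nonincreasing_seq F.
  move=> i j ij; apply/subsetPset => y;
    rewrite /F/= !in_itv/= => /andP[-> /le_trans]; apply.
  by rewrite lerD2l lef_pV2 ?posrE// ler_nat.
have : m \o F @ \oo --> m (\bigcap_k F k).
  apply: nonincreasing_cvg_mu => //; last by rewrite F0; exact: measurable0.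
  by rewrite -ge0_fin_numE// fin_num_measure.
rewrite F0 measure0.
move=> /fine_cvgP[_ /cvgrPdist_lt/(_ _ e0)[k _ /(_ k (leqnn k))]] /=.
rewrite sub0r normrN ger0_norm ?fine_ge0// -lte_fin fineK ?fin_num_measure// =>
  hk.
by exists (x + k.+1%:R^-1)%R => //; rewrite ltrDl.
Qed.

Lemma measure_NyE m (x y : R) : (x <= y)%R ->
  m `]-oo, y]%classic = m `]-oo, x]%classic + m `]x, y]%classic.
Proof.
move=> xy; rewrite -measureU//.
  by rewrite -itv_bndbnd_setU// bnd_simp.
by rewrite -subset0 => z []/=; rewrite !in_itv/= => + /andP[+ _];
  rewrite leNgt => /negP.
Qed.

Lemma lebesgue_stieltjes_measure_ocitv (f : cumulative R R) (x y : R) :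
  (x <= y)%R ->
  lebesgue_stieltjes_measure f `]x, y]%classic = (f y - f x)%:E.
Proof.
move=> xy; rewrite /lebesgue_stieltjes_measure /measure_extension/=.
by rewrite measurable_mu_extE/= ?wlength_itv_bnd//; exact: is_ocitv.
Qed.

(** The difference of the distribution functions is nondecreasing and
    right-continuous, so it is the distribution function of a measure [k]; the
    measures [m1 + k] and [m2] agree on half-open intervals, hence everywhere. *)
Lemma le_measure_ocitv m1 m2 :
  (forall x y : R, (x <= y)%R -> m1 `]x, y]%classic <= m2 `]x, y]%classic) ->
  forall D, measurable D -> m1 D <= m2 D.
Proof.
move=> m12 D mD.
pose G x := (fine (m2 `]-oo, x]%classic) - fine (m1 `]-oo, x]%classic))%R.
have GB x y : (x <= y)%R ->
    (G y - G x = fine (m2 `]x, y]%classic) - fine (m1 `]x, y]%classic))%R.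
  by move=> xy; rewrite /G !(measure_NyE _ xy) !fineD ?fin_num_measure//; ring.
have ndG : {homo G : x y / (x <= y)%R}.
  move=> x y xy; rewrite -subr_ge0 GB// subr_ge0 fine_le ?fin_num_measure//.
  exact: m12.
have rcG : right_continuous G.
  move=> x; apply/cvgrPdist_lt => e e0.
  have [y xy my] := measure_ocitv_right_cvg0 m2 x e0.
  near=> z; have xz : (x <= z)%R by apply/ltW; near: z; exact: nbhs_right_gt.
  have zy : (z < y)%R by near: z; exact: nbhs_right_lt.
  rewrite distrC ger0_norm ?subr_ge0 ?ndG// GB//.
  apply: (@le_lt_trans _ _ (fine (m2 `]x, z]%classic))).
    by rewrite gerBl fine_ge0.
  rewrite -lte_fin fineK ?fin_num_measure//; apply: le_lt_trans my.
  rewrite le_measure ?inE//.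
  by apply: subset_itvl; rewrite bnd_simp ltW.
pose Gc : cumulative R R := HB.pack G (isCumulative.Build R _ R G ndG rcG).
pose k : {measure set (measurableTypeR R) -> \bar R} :=
  lebesgue_stieltjes_measure Gc.
have kE x y : (x <= y)%R -> k `]x, y]%classic = (G y - G x)%:E.
  by move=> xy; rewrite [LHS]lebesgue_stieltjes_measure_ocitv.
have E : m2 D = measure_add m1 k D.
  apply: (@measure_unique _ _ (measurableTypeR R) (@ocitv R)
            (fun n => `](- n%:R)%R, n%:R]%classic)) => //.
  - exact: ocitvI.
  - by move=> i; exact: is_ocitv.
  - apply/seteqP; split => // x _; exists (Num.bound `|x|%R) => //=.
    have := archi_boundP (normr_ge0 x);
      rewrite ltr_norml in_itv/= => /andP[-> /ltW].
    by [].
  - move=> X [[x y] _ /= <-].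
    have [xy|yx] := leP x y;
      last by rewrite set_itv_ge ?bnd_simp -?leNgt ?ltW// !measure0.
    transitivity (m1 `]x, y]%classic + k `]x, y]%classic); last first.
      by rewrite [RHS]measure_addE.
    rewrite kE// GB// EFinB !fineK ?fin_num_measure//
      [RHS]addeC subeK ?fin_num_measure//.
  - by move=> i; rewrite -ge0_fin_numE//; exact: fin_num_measure.
by rewrite E measure_addE leeDl.
Unshelve. all: by end_near. Qed.

End measure_comparison.

Lemma finite_measureP {R : realType} (f : set (measurableTypeR R) -> \bar R) :
  f set0 = 0%E -> (forall D, 0 <= f D)%E -> semi_sigma_additive f ->
    fin_num_fun f ->
  exists m : {finite_measure set (measurableTypeR R) -> \bar R},
    m = f :> (set _ -> _).
Proof.
move=> f0 fge0 fadd ffin.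
pose m0 : {measure set (measurableTypeR R) -> \bar R} :=
  HB.pack f (isMeasure.Build _ _ _ f f0 fge0 fadd).
pose m : {finite_measure set (measurableTypeR R) -> \bar R} :=
  HB.pack (Measure.sort m0) (Measure_isFinite.Build _ _ _ m0 ffin).
by exists m.
Qed.

(** * Measures with a density *)
Section density.
Context {R : realType} (h : R -> R).
Hypothesis h0 : forall x, 0 <= h x.
Hypothesis ih : lebesgue_measure.-integrable setT (EFin \o h).
Local Notation lambda := (@lebesgue_measure R).

Definition density_of (D : set (measurableTypeR R)) : \bar R :=
  (\int[lambda]_(t in D) (h t)%:E)%E.

Lemma density_fin D : measurable D -> density_of D \is a fin_num.
Proof.
move=> mD; apply: integrable_fin_num => //; exact: integrableS ih.
Qed.

Lemma density_measure :
  exists m : {finite_measure set (measurableTypeR R) -> \bar R},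
    forall D, measurable D -> m D = density_of D.
Proof.
have mh : measurable_fun setT (EFin \o h) by exact: measurable_int ih.
have d0 : density_of set0 = 0%E by rewrite /density_of integral_set0.
have dge D : (0 <= density_of D)%E.
  by apply: integral_ge0 => x _; rewrite lee_fin.
have dsig : semi_sigma_additive density_of.
  move=> F mF tF mUF; rewrite /density_of ge0_integral_bigcup//.
  - apply: is_cvg_ereal_nneg_natsum => k _; exact: dge.
  - exact: measurable_funTS.
  - by move=> x _; rewrite lee_fin.
have [m mE] := finite_measureP d0 dge dsig density_fin.
by exists m => D _; rewrite mE.
Qed.
End density.

(** * Absolutely continuous measures and dominated densities *)
Section absolute_continuity.
Context {R : realType}.
Local Notation RL := (measurableTypeR R).
Local Notation lambda := (@lebesgue_measure R).
Implicit Types nu : {finite_measure set RL -> \bar R}.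
Local Open Scope ereal_scope.

Let mitv (i : interval R) : @measurable _ (measurableTypeR R) [set` i].
Proof. exact: measurable_itv. Qed.

#[local] Hint Extern 0 (measurable [set` _]) => solve [exact: mitv] : core.

(** Integrals of the Radon-Nikodym density are small over small sets. *)
Lemma finite_measure_ac nu : nu `<< lambda -> forall e : R, (0 < e)%R ->
  exists2 d : R, (0 < d)%R &
    forall D : set RL, measurable D -> lambda D < d%:E -> nu D < e%:E.
Proof.
move=> nul e e0; have [f [f0 ffin intf fE]] := radon_nikodym_sigma_finite nul.
have intf' : lambda.-integrable setT (EFin \o (fine \o f)).
  rewrite (_ : EFin \o _ = f)//; apply/funext => x /=; rewrite fineK//.
have [d [d0 hd]] := integral_normr_continuous intf' e0.
exists d => // D mD /(hd D mD); rewrite -lte_fin /Rintegral fineK; last first.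
  apply: integrable_fin_num => //; apply: (integrableS measurableT) => //.
  exact: integrable_norm.
congr (_ < _); rewrite fE//; apply: eq_integral => x _.
by rewrite /= ger0_norm ?fine_ge0// fineK.
Qed.

(** The definition speaks of disjoint open intervals and increments are masses
    of half-open ones, but points are null sets. *)
Lemma absolutely_continuous_on_measure nu (a b : R) (F : R -> R) :
  nu `<< lambda ->
  (forall u v, (a <= u)%R -> (u <= v)%R -> (v <= b)%R ->
    (F v - F u)%:E = nu `]u, v]%classic) ->
  absolutely_continuous_on a b F.
Proof.
move=> nul FE e e0; have [d d0 hd] := finite_measure_ac nul e0.
exists d => // n u v uv tuv suv.
have nu1 x : nu [set x] = 0.
  have /null_content_dominatesP := nul; apply; first exact: measurable_set1.
  exact: lebesgue_measure_set1.
have FoE i : `|F (v i) - F (u i)|%:E = nu `]u i, v i[%classic.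
  have [au ui vb] := uv i.
  have E := FE _ _ au ui vb.
  rewrite ger0_norm; last by rewrite -lee_fin E.
  rewrite E; move: ui; rewrite le_eqVlt => /predU1P[->|ui].
    by rewrite !set_itv_ge ?bnd_simp ?ltxx.
  rewrite -(@setUitv1 _ _ (BRight (u i)) (v i) true) ?bnd_simp// measureU//;
    last first.
    by rewrite -subset0 => x [/=]; rewrite in_itv/= => /andP[_ +] xv;
      rewrite xv ltxx.
  by rewrite [X in _ + X](nu1 (v i)) adde0.
rewrite -lte_fin -sumEFin (eq_bigr _ (fun i _ => FoE i)).
rewrite -(measure_bigsetU_ord _ xpredT)//; apply: hd;
  first exact: bigsetU_measurable.
rewrite measure_bigsetU_ord//.
rewrite (_ : \sum_(i < n) _ = (\sum_(i < n) (v i - u i))%R%:E) ?lte_fin//.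
rewrite -sumEFin; apply: eq_bigr => i _; have [_ ui _] := uv i.
rewrite [LHS]lebesgue_measure_itv/= lte_fin; case: ltP => // vu.
by rewrite (@le_anti _ _ (u i) (v i)) ?ui// subrr.
Qed.

(** The domination extends from half-open intervals to Borel sets, which gives
    absolute continuity. The Radon-Nikodym density can exceed [h] only on a null
    set, and truncating it there makes the bound hold everywhere. *)
Lemma bounded_density nu (h : R -> R) : (forall x, (0 <= h x)%R) ->
  lambda.-integrable setT (EFin \o h) ->
  (forall x y : R, (x <= y)%R ->
    nu `]x, y]%classic <= \int[lambda]_(t in `]x, y]) (h t)%:E) ->
  nu `<< lambda /\ exists f : R -> R,
    [/\ @measurable_fun _ _ RL R setT f, forall x, (0 <= f x <= h x)%R &
     forall D : set RL, measurable D -> nu D = \int[lambda]_(t in D) (f t)%:E].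
Proof.
move=> h0 ih nuh.
have [m mE] := density_measure h0 ih.
have le_nuh (D : set RL) : measurable D ->
  nu D <= \int[lambda]_(t in D) (h t)%:E.
  move=> mD; rewrite -[leRHS](mE _ mD); apply: le_measure_ocitv => // x y xy.
  rewrite mE; last exact: measurable_itv.
  exact: nuh.
have mh : measurable_fun setT (EFin \o h) by exact: measurable_int ih.
have mh' : @measurable_fun _ _ RL R setT h by exact/measurable_EFinP.
have nul : nu `<< lambda.
  apply/null_content_dominatesP => D mD D0; apply/eqP.
  rewrite eq_le measure_ge0 andbT; apply: le_trans (le_nuh D mD) _.
  by rewrite null_set_integral//; exact: measurable_funTS.
split=> //.
have [f [f0 ffin intf fE]] := radon_nikodym_sigma_finite nul.
have mf : measurable_fun setT f by exact: measurable_int intf.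
have mff : @measurable_fun _ _ RL R setT (fine \o f).
  by apply: measurableT_comp => //; exact: measurable_fine.
pose D := [set x : RL | (h x)%:E < f x].
have mD : measurable D.
  by rewrite -[D]setTI; exact: measurable_lte.
have lD0 : lambda D = 0.
  have iD0 : \int[lambda]_(x in D) `|f x - (h x)%:E| = 0.
    rewrite (eq_integral (fun x => f x - (h x)%:E)); last first.
      by move=> x /[!inE] xD; rewrite gee0_abs// sube_ge0 ?ltW// ffin.
    rewrite integralB//; try exact: integrableS intf; try exact: integrableS ih.
    apply/eqP; rewrite eq_le; apply/andP; split.
      rewrite sube_le0 -fE//; exact: le_nuh.
    rewrite sube_ge0; last first.
      by apply/orP; left; apply: integrable_fin_num => //;
        exact: integrableS ih.
    apply: ge0_le_integral => //.
    - by move=> x _; rewrite lee_fin.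
    - exact: measurable_funTS.
    - exact: measurable_funTS.
    - by move=> x xD; exact: ltW.
  have [] := (ae_eq_integral_abs lambda mD (f := fun x => f x - (h x)%:E) _).
    by apply: measurable_funTS; apply: emeasurable_funB.
  move=> /(_ iD0) [N [mN N0 DN]] _.
  apply/eqP; rewrite eq_le measure_ge0 andbT -N0; apply: le_measure;
    rewrite ?inE//.
  apply: subset_trans DN => x /= xD /(_ xD); apply/eqP.
  have xD' : 0 < f x - (h x)%:E by rewrite sube_gt0.
  by rewrite gt_eqF.
exists (fun x => Num.min (fine (f x)) (h x)); split.
- exact: measurable_minr.
- by move=> x; rewrite ge_min lexx orbT andbT le_min h0 fine_ge0.
- move=> E mE'; rewrite fE//; apply: ae_eq_integral => //.
  + exact: measurable_funTS.
  + by apply/measurable_EFinP; apply: measurable_funTS; exact: measurable_minr.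
  + exists D; split => // x /= /not_implyP[_ /eqP fx]; rewrite /D/= ltNge.
    apply/negP => fh; move/eqP: fx; apply; rewrite min_l ?fineK//.
    by rewrite -lee_fin fineK.
Qed.

End absolute_continuity.

(** * Increments of spectral functions *)
Section spectral_function_theory.
Local Open Scope complex_scope.
Context {R : realType} {H : hilbertType R} (P : pvm H).
Implicit Types (x : H) (a b s t u v : R).
Local Notation RL := (measurableTypeR R).

(** Lebesgue measure lives on the sigma-algebra generated by the half-open
    intervals, spectral measures on the Borel structure of the line. The sets
    are the same but the two structures are not, so the measure is rebuilt. *)
Lemma scalar_measure_on_RL x :
  exists nu : {finite_measure set RL -> \bar R},
    forall D, nu D = scalar_measure P x D.
Proof.
have [||||nu nuE] := @finite_measureP R (scalar_measure P x); last first.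
- by exists nu => D; rewrite nuE.
- by [].
- exact: (@measure_semi_sigma_additive _ _ _ (scalar_measure P x)).
- exact: (measure_ge0 (scalar_measure P x)).
- exact: (measure0 (scalar_measure P x)).
Qed.

Lemma sqr_hnorm_pvmU A B x : measurable A -> measurable B -> A `&` B = set0 ->
  hnorm (P (A `|` B) x) ^+ 2 = hnorm (P A x) ^+ 2 + hnorm (P B x) ^+ 2.
Proof.
move=> mA mB AB; rewrite !sqr_hnorm_pvm//; last exact: measurableU.
by rewrite pvmU// rinnerDl.
Qed.

Lemma sqr_hnorm_pvm_itv x s t : s <= t ->
  hnorm (P `]s, t]%classic x) ^+ 2 =
  hnorm (P `]-oo, t]%classic x) ^+ 2 - hnorm (P `]-oo, s]%classic x) ^+ 2.
Proof.
move=> st; apply/eqP; rewrite eq_sym subr_eq addrC -sqr_hnorm_pvmU//.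
  by rewrite -itv_bndbnd_setU// bnd_simp.
by rewrite -subset0 => z []/=; rewrite !in_itv/= => + /andP[+ _];
  rewrite leNgt => /negP.
Qed.

Lemma spectral_functionE b x l : spectral_function b P x l =
  hnorm (resolution b P l x) ^+ 2.
Proof. by rewrite /spectral_function /resolution; case: ifPn => _;
  rewrite sqr_hnorm_pvm. Qed.

Lemma spectral_function_lt b x l : l < b ->
  spectral_function b P x l = hnorm (P `]-oo, l]%classic x) ^+ 2.
Proof. by move=> lb; rewrite spectral_functionE /resolution lb. Qed.

(** With the endpoint conventions of [resolution], a jump at [a] or at [b] is
    never seen from inside [[a, b]]. Replacing [x] by its component over
    [`]a, b[] expresses this for all subintervals at once. *)
Lemma spectral_functionB a b x u v : a <= u -> u <= v -> v <= b ->
  spectral_function b P x v - spectral_function b P x u =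
  hnorm (P `]u, v]%classic (P `]a, b[%classic x)) ^+ 2.
Proof.
move=> au uv vb; rewrite pvmI//.
have [vb'|bv] := ltP v b.
  rewrite !spectral_function_lt// ?(le_lt_trans uv)//.
  rewrite -sqr_hnorm_pvm_itv// setIidl// => l /=;
    rewrite !in_itv/= => /andP[ul lv].
  by rewrite (le_lt_trans au)// (le_lt_trans lv).
have {vb bv}vb : v = b by apply/eqP; rewrite eq_le vb.
subst v; move: uv; rewrite le_eqVlt => /predU1P[->|ub].
  by rewrite subrr set_itv_ge ?bnd_simp ?ltxx// set0I pvm0 hnorm0 expr0n.
rewrite [X in _ - X]spectral_function_lt// spectral_functionE /resolution ltxx.
apply/eqP; rewrite subr_eq addrC -sqr_hnorm_pvmU//; last 2 first.
- exact: measurableI.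
- by rewrite -subset0 => l []/=; rewrite !in_itv/= => + [/andP[+ _] _];
  rewrite leNgt => /negP.
apply/eqP; congr (hnorm (P _ x) ^+ 2); apply/seteqP; split => l/=;
  rewrite !in_itv/=.
  move=> lb; case: (leP l u) => lu; [left|right] => //.
  by rewrite lb (ltW lb) (le_lt_trans au).
by move=> [/le_lt_trans|[_ /andP[_ ->]]]//; apply.
Qed.

End spectral_function_theory.

(** * A criterion for a point to be in the spectrum *)
Section spectrum_criterion.
Local Open Scope complex_scope.
Context {R : realType} {H : hilbertType R} (A : operator H) (P : pvm H).
Hypothesis saA : self_adjoint A.
Hypothesis AP : is_spectral_measure A P.

(** In the range of [P `]s, t]] the operator [A - l] has norm at most [e]. A
    bounded inverse would be continuous at 0, but would have to map vectors of
    norm at most [e] to unit vectors, for every [e]. *)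
Lemma spectrum_of_support (l : R) :
  (forall e, 0 < e -> exists s t x,
     [/\ l - e <= s, t <= l + e & P `]s, t]%classic x != 0]) ->
  spectrum A l%:C.
Proof.
move=> supp [S [cS _ SA]].
have := cS 0; rewrite /continuous_at linear0 => /cvgrPdist_lt/(_ 1 ltr01).
move=> /nbhs_ballP[d /= d0 hd].
have dR : d = (complex.Re d)%:C by rewrite RRe_real// gtr0_real.
have e0 : 0 < complex.Re d by rewrite -ltcR -dR.
have e20 : 0 < complex.Re d / 2 by rewrite divr_gt0.
have [s [t [x [ls tl x0]]]] := supp _ e20.
set z := P _ x in x0.
have z0 : 0 < hnorm z.
  by rewrite lt0r hnorm_ge0 andbT; apply: contraNneq x0 => /hnorm0_eq0 ->.
have mI : measurable `]s, t]%classic by exact: measurable_itv.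
have Iz : P `]s, t]%classic z = z by exact: pvmK.
set w := (hnorm z)^-1%:C *: z.
have Iw : P `]s, t]%classic w = w by rewrite pvmZ// Iz.
have w1 : hnorm w = 1.
  by rewrite hnormZ ger0_norm ?invr_ge0 ?hnorm_ge0// mulVf// gt_eqF.
have Ile r : `]s, t]%classic r -> `|r - l| <= complex.Re d / 2.
  rewrite /= in_itv/= => /andP[sr rt]; rewrite ler_distl.
  by rewrite (le_trans ls (ltW sr)) (le_trans rt tl).
have Aw : dom A w by exact: (dom_pvm_near AP mI Ile Iw).
have := sub_scalar_le saA AP mI Iw Ile; rewrite w1 mulr1 => hw.
have w_ball : ball 0 d (sub_scalar A l w).
  rewrite -ball_normE/= sub0r normrN hnormE dR ltcR.
  by apply: le_lt_trans hw _; lra.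
by have := hd _ w_ball; rewrite /sub_scalar SA// sub0r normrN hnormE w1 ltxx.
Qed.

End spectrum_criterion.

(** * The integral as a modulus of continuity *)
Section modulus.
Local Open Scope complex_scope.
Context {R : realType} (h : R -> R).
Local Notation lambda := (@lebesgue_measure R).
Hypothesis h0 : forall x, 0 <= h x.
Hypothesis ih : lambda.-integrable setT (EFin \o h).
Implicit Types u v w : R.

Definition mass u v : R := \int[lambda]_(t in `]u, v]) h t.

Let ihS (i : interval R) : lambda.-integrable [set` i] (EFin \o h).
Proof. by apply: (integrableS measurableT) => //; exact: measurable_itv. Qed.

Lemma massE u v : (mass u v)%:E = (\int[lambda]_(t in `]u, v]) (h t)%:E)%E.
Proof.
rewrite /mass /Rintegral fineK//; exact: integrable_fin_num.
Qed.

Lemma mass_ge0 u v : 0 <= mass u v.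
Proof. exact: Rintegral_ge0. Qed.

Lemma massD u v w : u <= v -> v <= w -> mass u w = mass u v + mass v w.
Proof.
move=> uv vw; rewrite /mass.
have := @Rintegral_itvB R h (BRight u) (BRight w) v (ihS _).
by rewrite !bnd_simp => /(_ uv vw) <-; rewrite addrC subrK.
Qed.

Lemma mass_small e : 0 < e -> exists2 d, 0 < d &
  forall u v, u <= v -> v - u < d -> mass u v < e.
Proof.
move=> e0; have [d [d0 hd]] := integral_normr_continuous ih e0.
exists d => // u v uv vud; rewrite /mass.
rewrite (_ : h = fun t => `|h t|); last by apply/funext => t; rewrite ger0_norm.
apply: hd; first exact: measurable_itv.
rewrite [ltLHS]lebesgue_measure_itv/=; case: ifP => // _.
Qed.

(** The same [d] works for all [F]: this equicontinuity is what makes the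
    convergence uniform. *)
Lemma mass_itv_small a b e : 0 < e -> exists2 d, 0 < d &
  forall F : R -> R,
  (forall u v, a <= u -> u <= v -> v <= b -> 0 <= F v - F u <= mass u v) ->
  forall u v, a <= u <= b -> a <= v <= b -> `|u - v| < d -> `|F u - F v| < e.
Proof.
move=> e0; have [d d0 hd] := mass_small e0; exists d => // F FE u v.
wlog uv : u v / u <= v.
  move=> W; case: (leP u v) => [|/ltW] uv ua va; first exact: W.
  by rewrite distrC (distrC (F u)); exact: W.
move=> /andP[au ub] /andP[av vb].
have /andP[F0 Fm] := FE u v au uv vb.
rewrite distrC ger0_norm ?subr_ge0// distrC ger0_norm// => uvd.
by apply: le_lt_trans Fm _; exact: hd.
Qed.

End modulus.

Lemma exists_lt_near {R : realType} (a l d : R) : a < l -> 0 < d ->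
  exists s, [/\ a < s, s < l & l - s < d].
Proof.
move=> al d0; exists (Num.max ((a + l) / 2) (l - d / 2)); split.
- by rewrite lt_max; apply/orP; left; lra.
- by rewrite gt_max; apply/andP; split; lra.
- by rewrite ltrBlDr -ltrBlDl lt_max; apply/orP; right; lra.
Qed.

Lemma exists_gt_near {R : realType} (l b d : R) : l < b -> 0 < d ->
  exists t, [/\ l < t, t < b & t - l < d].
Proof.
move=> lb d0; have [] := @exists_lt_near _ (- b) (- l) d; rewrite ?ltrN2//.
by move=> s [bs sl sd]; exists (- s); split; lra.
Qed.

(** * Convergence of the spectral functions *)
Section limit_spectral_function.
Local Open Scope complex_scope.
Context {R : realType} {H : hilbertType R}.
Variables (A_ : nat -> operator H) (P_ : nat -> pvm H).
Variables (A : operator H) (P : pvm H) (Phi : set H).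
Hypothesis saA_ : forall n, self_adjoint (A_ n).
Hypothesis AP_ : forall n, is_spectral_measure (A_ n) (P_ n).
Hypothesis saA : self_adjoint A.
Hypothesis AP : is_spectral_measure A P.
Hypothesis PhiA : forall n, Phi `<=` dom (A_ n).
Hypothesis cvgA : forall e, Phi e -> cvg (A_ n e @[n --> \oo]).
Hypothesis graphA : graph A = closure (limit_graph A_ Phi).
Variables (x : H) (a b C : R) (h : R -> R).
Implicit Types (s t u v e : R).
Local Notation lambda := (@lebesgue_measure R).

Local Notation F_ n s := (hnorm (P_ n `]-oo, s]%classic x) ^+ 2).
Local Notation F s := (hnorm (P `]-oo, s]%classic x) ^+ 2).

Let sqr_le e : 0 < e -> exists2 eta, 0 < eta &
  forall y z, 0 <= y -> 0 <= z -> z <= hnorm x -> y <= z + eta ->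
    y ^+ 2 <= z ^+ 2 + e.
Proof.
move=> e0; have X0 : 0 < 2 * hnorm x + 1.
  by rewrite ltr_wpDl// mulr_ge0// hnorm_ge0.
(* [(z + eta)^2 = z^2 + eta (2 z + eta)], with [z <= |x|] and [eta <= 1]. *)
pose eta := Num.min 1 (e / (2 * hnorm x + 1)).
exists eta; first by rewrite lt_min ltr01 divr_gt0.
have eta0 : 0 <= eta by rewrite le_min ler01 divr_ge0// ltW.
have eta1 : eta <= 1 by rewrite ge_min lexx.
have etae : eta * (2 * hnorm x + 1) <= e.
  by rewrite -ler_pdivlMr// ge_min lexx orbT.
move=> y z y0 z0 zx yz.
apply: (@le_trans _ _ ((z + eta) ^+ 2)).
  by rewrite lerXn2r ?nnegrE// addr_ge0.
nra.
Qed.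

(** The projections [P_ n `]-oo, s]] asymptotically annihilate the component of
    [x] in the range of [P `]t, +oo[]. What remains is at most the norm of the
    component in the range of [P `]-oo, t]]. *)
Lemma limit_le s t e : s < t -> 0 < e -> \forall n \near \oo, F_ n s <= F t + e.
Proof.
move=> st e0; have [eta eta0 sq] := sqr_le e0.
have mt : measurable `]-oo, t]%classic by exact: measurable_itv.
have mt' : measurable `]t, +oo[%classic by exact: measurable_itv.
have tx : P `]t, +oo[%classic (P `]t, +oo[%classic x) = P `]t, +oo[%classic x.
  exact: pvmK.
have := left_right_cvg0 saA_ AP_ saA AP PhiA cvgA graphA st tx eta0.
apply: filterS => n close; apply: sq; rewrite ?hnorm_ge0//;
  first exact: hnorm_pvm_le.
have {1}-> : x = P `]-oo, t]%classic x + P `]t, +oo[%classic x.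
  by rewrite -setCitvl pvmC// addrC subrK.
rewrite pvmD//; apply: le_trans (ler_hnormD _ _) _; apply: lerD;
  last exact: ltW.
exact: hnorm_pvm_le.
Qed.

(** The same for the complementary half-lines; squared norms of complementary
    components add up to [|x|^2]. *)
Lemma limit_ge s t e : s < t -> 0 < e -> \forall n \near \oo, F s <= F_ n t + e.
Proof.
move=> st e0; have [eta eta0 sq] := sqr_le e0.
have ms : measurable `]-oo, s]%classic by exact: measurable_itv.
have ms' : measurable `]s, +oo[%classic by exact: measurable_itv.
have mt : measurable `]-oo, t]%classic by exact: measurable_itv.
have mt' : measurable `]t, +oo[%classic by exact: measurable_itv.
have sx : P `]-oo, s]%classic (P `]-oo, s]%classic x) = P `]-oo, s]%classic x.
  exact: pvmK.
have := right_left_cvg0 saA_ AP_ saA AP PhiA cvgA graphA st sx eta0.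
apply: filterS => n close.
have : hnorm (P_ n `]t, +oo[%classic x) ^+ 2 <=
  hnorm (P `]s, +oo[%classic x) ^+ 2 + e.
  apply: sq; rewrite ?hnorm_ge0//; first exact: hnorm_pvm_le.
  have {1}-> : x = P `]s, +oo[%classic x + P `]-oo, s]%classic x.
    by rewrite -setCitvl pvmC// subrK.
  rewrite pvmD//; apply: le_trans (ler_hnormD _ _) _; apply: lerD;
    last exact: ltW.
  exact: hnorm_pvm_le.
have := sqr_hnorm_pvmC P x ms; have := sqr_hnorm_pvmC (P_ n) x mt.
rewrite !setCitvl; lra.
Qed.

Hypothesis ab : a < b.
Hypothesis h0 : forall t, 0 <= h t.
Hypothesis ih : lambda.-integrable setT (EFin \o h).
Hypothesis C0 : 0 < C.
Hypothesis F_bound : forall n u v, a <= u -> u <= v -> v <= b ->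
  C * (v - u) <= spectral_function b (P_ n) x v - spectral_function b (P_ n) x u
    <= mass h u v.

(** The half-lines in [limit_le] and [limit_ge] have to be separated, so the
    bound is first obtained with the mass of a slightly larger interval; then
    the continuity of the mass is used. *)
Lemma limit_increment_le u v : a < u -> u <= v -> v < b ->
  F v - F u <= mass h u v.
Proof.
move=> au uv vb; apply/ler_addgt0Pr => e e0.
have e40 : 0 < e / 4 by rewrite divr_gt0.
have [d d0 hd] := mass_small h0 ih e40.
have [u' [au' u'u u'd]] := exists_lt_near au d0.
have [v' [vv' v'b v'd]] := exists_gt_near vb d0.
have [n [h1 h2]] := filter_ex (filterI (limit_ge vv' e40) (limit_le u'u e40)).
have u'v' : u' <= v' by rewrite (le_trans (ltW u'u))// (le_trans uv)// ltW.
have /andP[_ hb] := F_bound n (ltW au') u'v' (ltW v'b).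
rewrite !spectral_function_lt// ?(le_lt_trans u'v')// in hb.
have m1 := hd _ _ (ltW u'u) u'd; have m2 := hd _ _ (ltW vv') v'd.
rewrite (massD ih (ltW u'u) (le_trans uv (ltW vv'))) (massD ih uv (ltW vv')) in
  hb.
lra.
Qed.

(** Dually, the lower bound passes to the limit at the price of a slightly
    smaller interval, which suffices for positivity. *)
Lemma limit_increment_gt0 s t : a < s -> s < t -> t < b ->
  P `]s, t]%classic x != 0.
Proof.
move=> as_ st tb.
(* Any [s' < t'] strictly between [s] and [t] would do. *)
pose s' := (2 * s + t) / 3; pose t' := (s + 2 * t) / 3.
have ss' : s < s' by rewrite /s'; lra.
have st' : s' < t' by rewrite /s' /t'; lra.
have tt' : t' < t by rewrite /t'; lra.
have e0 : 0 < C * (t' - s') / 4 by rewrite divr_gt0// mulr_gt0// subr_gt0.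
have [n [h1 h2]] := filter_ex (filterI (limit_ge ss' e0) (limit_le tt' e0)).
have as' : a <= s' by rewrite ltW// (lt_trans as_).
have tb' : t' < b by exact: lt_trans tb.
have /andP[hb _] := F_bound n as' (ltW st') (ltW tb').
rewrite !spectral_function_lt// ?(lt_trans st')// in hb.
apply: contraTneq e0 => Px0; rewrite -leNgt.
have := sqr_hnorm_pvm_itv P x (ltW st); rewrite Px0 hnorm0 expr0n/=.
move: hb h1 h2; set D := C * _; clearbody s' t' D; lra.
Qed.

(** The part of [`]u, v]] in [`]a, b[] is exhausted by half-open intervals whose
    endpoints are inside [`]a, b[], where [limit_increment_le] applies. Atoms at
    [a] and [b], which the limit may have, stay outside. *)
Lemma limit_measure_le u v : u <= v ->
  hnorm (P `]u, v]%classic (P `]a, b[%classic x)) ^+ 2 <= mass h u v.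
Proof.
move=> uv; rewrite pvmI//; try exact: measurable_itv.
pose U k := Num.max u (a + k.+1%:R^-1); pose V k := Num.min v (b - k.+1%:R^-1).
pose S k := `]U k, V k]%classic.
have mS k : measurable (S k) by exact: measurable_itv.
have k0 k : 0 < k.+1%:R^-1 :> R by rewrite invr_gt0.
have USV : \bigcup_k S k = `]u, v] `&` `]a, b[%classic.
  apply/seteqP; split => l.
    move=> [k _]; rewrite /S/= !in_itv/= gt_max le_min =>
      /andP[/andP[-> al] /andP[-> lb]].
    rewrite (lt_trans _ al) ?ltrDl// (le_lt_trans lb)// ltrBlDr ltrDl//.
  move=> [] /=; rewrite !in_itv/= => /andP[ul lv] /andP[al lb].
  have m0 : 0 < Num.min (l - a) (b - l) by rewrite lt_min !subr_gt0 al.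
  (* From this index on, [1 / (k + 1)] is less than the distance from [l] to [a]
     and to [b]. *)
  exists (Num.truncn (Num.min (l - a) (b - l))^-1) => //.
  rewrite /S/= in_itv/= gt_max le_min ul lv /=.
  have : (Num.truncn (Num.min (l - a) (b - l))^-1).+1%:R^-1 < Num.min (l - a)
    (b - l).
    by rewrite invf_plt ?posrE// real_truncnS_gt ?num_real.
  rewrite lt_min => /andP[k1 k2].
  by rewrite -ltrBrDl k1 lerBrDr -lerBrDl ltW.
have ndS : nondecreasing_seq S.
  move=> i j ij; apply/subsetPset => l; rewrite /S/= !in_itv/=.
  have ji : j.+1%:R^-1 <= i.+1%:R^-1 :> R by rewrite lef_pV2 ?posrE// ler_nat.
  rewrite !gt_max !le_min => /andP[/andP[-> al] /andP[-> lb]] /=.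
  by rewrite (le_lt_trans _ al) ?lerD2l// (le_trans lb)// lerD2l lerN2.
have cS : (scalar_measure P x) (S k) @[k --> \oo] -->
    scalar_measure P x (`]u, v]%classic `&` `]a, b[%classic).
  by rewrite -USV; apply: nondecreasing_cvg_mu => //; exact: bigcup_measurable.
rewrite -lee_fin -scalar_measure_hnorm -(cvg_lim _ cS)//.
apply: lime_le; first by apply/cvg_ex; eexists; exact: cS.
apply: nearW => k; rewrite scalar_measure_hnorm lee_fin.
have [UVk|VUk] := leP (U k) (V k); last first.
  rewrite /S set_itv_ge; last by rewrite bnd_simp -leNgt ltW.
  by rewrite pvm0 hnorm0 expr0n/= mass_ge0.
have aU : a < U k by rewrite lt_max ltrDl k0 orbT.
have Vb : V k < b by rewrite gt_min ltrBlDr ltrDl k0 orbT.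
have uU : u <= U k by rewrite le_max lexx.
have Vv : V k <= v by rewrite ge_min lexx.
rewrite /S sqr_hnorm_pvm_itv//;
  apply: le_trans (limit_increment_le aU UVk Vb) _.
rewrite (massD ih uU (le_trans UVk Vv)) (massD ih UVk Vv).
have := mass_ge0 h0 u (U k); have := mass_ge0 h0 (V k) v; lra.
Qed.

Lemma limit_bound u v : a <= u -> u <= v -> v <= b ->
  0 <= spectral_function b P x v - spectral_function b P x u <= mass h u v.
Proof.
move=> au uv vb; rewrite (spectral_functionB _ _ au uv vb) sqr_ge0/=.
exact: limit_measure_le.
Qed.

Lemma approximation_bound n u v : a <= u -> u <= v -> v <= b ->
  0 <= spectral_function b (P_ n) x v - spectral_function b (P_ n) x u <=
    mass h u v.
Proof.
move=> au uv vb; have /andP[h1 ->] := F_bound n au uv vb; rewrite andbT.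
by apply: le_trans h1; rewrite mulr_ge0 ?subr_ge0// ltW.
Qed.

(** The limit has no mass concentrated near [l], so the values at the auxiliary
    points [s < l < t] squeeze the value at [l]. *)
Lemma pointwise_cvg l e : a < l -> l < b -> 0 < e -> \forall n \near \oo,
  `|spectral_function b (P_ n) x l - spectral_function b P x l| < e.
Proof.
move=> al lb e0; have e20 : 0 < e / 2 by rewrite divr_gt0.
have e40 : 0 < e / 4 by rewrite divr_gt0.
have [d d0 hd] := mass_small h0 ih e20.
have [s [as_ sl sd]] := exists_lt_near al d0.
have [t [lt_ tb td]] := exists_gt_near lb d0.
have m1 := hd _ _ (ltW sl) sd; have m2 := hd _ _ (ltW lt_) td.
have i1 := limit_increment_le as_ (ltW sl) lb.
have i2 := limit_increment_le al (ltW lt_) tb.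
near=> n.
have h1 : F s <= F_ n l + e / 4 by near: n; exact: limit_ge.
have h2 : F_ n l <= F t + e / 4 by near: n; exact: limit_le.
rewrite !spectral_function_lt// ltr_norml; apply/andP; split; lra.
Unshelve. all: by end_near. Qed.

(** Around any point of [[a, b]], an endpoint for instance, all functions are
    close to their values at an interior point [t], where [pointwise_cvg] holds.
    Compactness of [[a, b]] makes the rank uniform. *)
Lemma uniform_cvg_spectral_function e : 0 < e -> \forall n \near \oo,
  forall l, a <= l <= b ->
  `|spectral_function b (P_ n) x l - spectral_function b P x l| < e.
Proof.
move=> e0; have e30 : 0 < e / 3 by rewrite divr_gt0.
have [d d0 hd] := mass_itv_small h0 ih a b e30.
have : compact `[a, b] by exact: segment_compact.
move=> /compact_near_coveringP/(_ _ \oo (fun n l => a <= l <= b ->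
    `|spectral_function b (P_ n) x l - spectral_function b P x l| < e) _).
have loc l0 : `[a, b]%classic l0 -> \forall l \near l0 & n \near \oo,
    a <= l <= b ->
    `|spectral_function b (P_ n) x l - spectral_function b P x l| < e.
  rewrite /= in_itv/= => /andP[al0 l0b].
  (* Moving by [m] towards the middle of [[a, b]] stays inside it. *)
  pose m := Num.min (d / 4) ((b - a) / 4).
  have m0 : 0 < m by rewrite lt_min !divr_gt0// subr_gt0.
  have md : m <= d / 4 by rewrite ge_min lexx.
  have mab : m <= (b - a) / 4 by rewrite ge_min lexx orbT.
  have [t [at_ tb tl0]] : exists t, [/\ a < t, t < b & `|t - l0| <= m].
    have [lm|lm] := leP l0 ((a + b) / 2).
      exists (l0 + m); split; [lra|lra|].
      by rewrite addrAC subrr add0r ger0_norm// ltW.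
    exists (l0 - m); split; [lra|lra|].
    by rewrite addrAC subrr add0r normrN ger0_norm// ltW.
  near=> l n => alb.
  have hl : `|l0 - l| < d / 2.
    by near: l; apply: cvgr_dist_lt; [exact: cvg_id|rewrite divr_gt0].
  have close : `|spectral_function b (P_ n) x t - spectral_function b P x t| <
    e / 3.
    by near: n; exact: pointwise_cvg.
  have atb : a <= t <= b by rewrite (ltW at_) (ltW tb).
  have lt_ : `|l - t| < d.
    move: hl tl0; rewrite !ltr_norml !ler_norml => /andP[? ?] /andP[? ?].
    by apply/andP; split; lra.
  have h1 := hd _ (approximation_bound n) _ _ alb atb lt_.
  have h2 := hd _ limit_bound _ _ alb atb lt_.
  move: close h1 h2; rewrite !ltr_norml => /andP[? ?] /andP[? ?] /andP[? ?].
  by apply/andP; split; lra.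
move=> /(_ loc); apply: filterS => n close l alb.
by apply: close => //=; rewrite in_itv.
Unshelve. all: by end_near. Qed.

End limit_spectral_function.

(** * Almost everywhere inequalities and Lebesgue spaces *)
Section integral_facts.
Context {R : realType}.
Local Notation RL := (measurableTypeR R).
Local Notation lambda := (@lebesgue_measure R).

Lemma ae_le_Rintegral (D : set RL) (f1 f2 : R -> R) : measurable D ->
  lambda.-integrable D (EFin \o f1) -> lambda.-integrable D (EFin \o f2) ->
  {ae lambda, forall t, D t -> f1 t <= f2 t} ->
  \int[lambda]_(t in D) f1 t <= \int[lambda]_(t in D) f2 t.
Proof.
move=> mD if1 if2 [N [mN N0 DN]].
have mDN : measurable (D `\` N) by exact: measurableD.
have iS f : lambda.-integrable D (EFin \o f) ->
  lambda.-integrable (D `\` N) (EFin \o f).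
  by apply: integrableS => //; exact: subDsetl.
rewrite /Rintegral (negligible_integral mN mD if1 N0)
  (negligible_integral mN mD if2 N0).
rewrite fine_le//; try by apply: integrable_fin_num => //; exact: iS.
apply: le_integral; [exact: mDN|exact: iS|exact: iS|].
move=> t /[!inE] -[Dt Nt]; rewrite lee_fin; apply: contrapT => f12.
by apply: Nt; apply: DN => /= /(_ Dt).
Qed.

(** [|g| <= 1 + |g|^p], and [[a, b]] has finite measure. *)
Lemma Lp_on_integrable (p a b : R) (g : R -> R) : 1 <= p -> Lp_on p a b g ->
  lambda.-integrable setT (EFin \o (fun t => `|(g \_ `[a, b]) t|)).
Proof.
move=> p1 gp; set gab := g \_ `[a, b].
have mab : @measurable _ RL `[a, b]%classic by exact: measurable_itv.
have mg : @measurable_fun _ _ RL R setT gab.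
  by move: gp; rewrite /Lp_on/= inE => /andP[/[!inE]].
have igp := Lfun_integrable p1 gp.
have i1 : lambda.-integrable setT
  (EFin \o (\1_(`[a, b]%classic : set RL) : R -> R)).
  exact: integrable_indic_itv.
apply: le_integrable (integrableD measurableT i1 igp) => //.
  by apply/measurable_EFinP; exact: measurableT_comp.
move=> t _ /=; rewrite lee_fin normr_id; apply: le_trans (ler_norm _).
rewrite /gab patchE indicE; case: ifPn => tab; last first.
  have -> : `|point : R| = 0 by rewrite normr0.
  by rewrite addr_ge0 ?powR_ge0.
rewrite /= mulr1n; have [g1|/ltW g1] := leP `|g t| 1.
  by rewrite ler_wpDr ?powR_ge0.
by rewrite -[leLHS]powRr1// ler_wpDl// ler_powR.
Qed.

Lemma Lp_on_le (p a b : R) (f g : R -> R) : 1 <= p ->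
  @measurable_fun _ _ RL R setT f ->
  (forall t, `|f t| <= `|(g \_ `[a, b]) t|) -> Lp_on p a b g -> Lp_on p a b f.
Proof.
move=> p1 mf fg gp.
have mab : @measurable _ RL `[a, b]%classic by exact: measurable_itv.
have mfab : @measurable_fun _ _ RL R setT (f \_ `[a, b]).
  by apply/(measurable_restrictT _ mab); exact: measurable_funTS.
have mg : @measurable_fun _ _ RL R setT (g \_ `[a, b]).
  by move: gp; rewrite /Lp_on/= inE => /andP[/[!inE]].
have p0 : p != 0 by rewrite gt_eqF// (lt_le_trans ltr01).
move: gp; rewrite /Lp_on/= !inE => /andP[_ /[!inE] gp]; apply/andP; split;
  rewrite inE//.
move: gp; rewrite /finite_norm/= => /(poweR_lty p); rewrite powR_Lnorm// => gp.
rewrite unlock; apply: poweR_lty; apply: le_lt_trans gp.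
have mpow (k : R -> R) : @measurable_fun _ _ RL R setT k ->
    measurable_fun setT (fun x : RL => `|(EFin \o k) x| `^ p)%E.
  move=> mk; apply: (measurableT_comp (measurable_poweR _)).
  by apply: measurableT_comp => //; exact/measurable_EFinP.
apply: ge0_le_integral => //; try exact: mpow.
- by move=> t _; exact: poweR_ge0.
- move=> t _ /=; rewrite lee_fin ge0_ler_powR ?nnegrE//.
    by rewrite (le_trans _ p1).
  rewrite patchE; case: ifPn => // _; by rewrite normr0.
Qed.

End integral_facts.

(** * Null sets of a generating vector *)
Section generating_null.
Context {R : realType} {H : hilbertType R} (P : pvm H).

(** [P N] commutes with the [P I], so it vanishes on every [P I e0], on their
    span, and by continuity on the closure. Thus null sets of the scalar measure
    of [e0] are null sets of all scalar measures. *)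
Lemma generating_vector_eq0 (e0 : H) (N : set R) : measurable N ->
  generating_vector P e0 -> P N e0 = 0 -> forall e, P N e = 0.
Proof.
move=> mN gen N0 e; apply: hnorm0_eq0; apply/eqP.
rewrite eq_le hnorm_ge0 andbT; apply/ler_addgt0Pr => d d0; rewrite add0r.
have : closure (linear_span [set P [set` I] e0 | I in [set: interval R]]) e.
  by rewrite gen.
have dC : (0 : R[i]) < d%:C%C by rewrite ltcR.
move=> /(_ _ (nbhsx_ballx e _ dC)) [_ [[n [c [v [vS ->]]]]]].
set w := \sum_(i < n) _; rewrite -ball_normE/= hnormE ltcR => ew.
have Nw : P N w = 0.
  rewrite /w; elim/big_rec: _ => [|i y _ IH]; first exact: pvmx0.
  rewrite pvm_lin// IH addr0; have [I _ <-] := vS i.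
  have mI : measurable [set` I] by exact: measurable_itv.
  by rewrite pvmI// setIC -pvmI// N0 pvmx0// scaler0.
rewrite -[e](subrK w) pvmD// Nw addr0.
by apply: ltW; apply: le_lt_trans ew; exact: hnorm_pvm_le.
Qed.
End generating_null.

Theorem theorem1p3 (R : realType) (H : hilbertType R) (a b : R)
    (A_ : nat -> operator H) (P_ : nat -> pvm H) (A : operator H) (P : pvm H)
    (Phi : set H) (e0 : H) (f_ : nat -> R -> R) (p C : R) (g : R -> R)
    (sigma_ := fun n => spectral_function b (P_ n) e0)
    (sigma := spectral_function b P e0) :
  separable H ->
  a < b ->
  (forall n, self_adjoint (A_ n)) ->
  (forall n, is_spectral_measure (A_ n) (P_ n)) ->
  (forall n, ac_spectrum_on a b (P_ n)) ->
  dense Phi ->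
  (forall n, Phi `<=` dom (A_ n)) ->
  (forall e, Phi e -> cvg (A_ n e @[n --> \oo])) ->
  graph A = closure (limit_graph A_ Phi) ->
  self_adjoint A ->
  is_spectral_measure A P ->
  generating_vector P e0 ->
  (forall n, lebesgue_measure.-integrable `[a, b] (EFin \o f_ n)) ->
  (forall n l, a <= l <= b ->
     sigma_ n l = sigma_ n a + \int[lebesgue_measure]_(t in `[a, l]) f_ n t) ->
  0 < C ->
  1 <= p ->
  Lp_on p a b g ->
  {ae lebesgue_measure, forall t, t \in `[a, b] -> 0 < g t} ->
  (forall n, {ae lebesgue_measure, forall t, t \in `[a, b] ->
     C <= f_ n t <= g t}) ->
  [/\ purely_ac_spectrum_on a b A P,
      exists2 f : R -> R, Lp_on p a b f &
        forall l, a <= l <= b ->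
          sigma l = sigma a + \int[lebesgue_measure]_(t in `[a, l]) f t &
      {uniform `[a, b], sigma_ @ \oo --> sigma}].
Proof.
move=> _ ab saA_ AP_ _ _ PhiA cvgA graphA saA AP gen if_ sigmaE C0 p1 gp _ Cfg.
(* A version of [g] that is nonnegative and integrable on the whole line. *)
pose h t := `|(g \_ `[a, b]) t|.
have h0 t : 0 <= h t by exact: normr_ge0.
have ih : lebesgue_measure.-integrable setT (EFin \o h) :=
  Lp_on_integrable p1 gp.
have mitv (i : interval R) : @measurable _ (measurableTypeR R) [set` i].
  exact: measurable_itv.
have F_bound n u v : a <= u -> u <= v -> v <= b ->
    C * (v - u) <= sigma_ n v - sigma_ n u <= mass h u v.
  move=> au uv vb.
  have uvab : `]u, v]%classic `<=` `[a, b]%classic.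
    by move=> t /=; rewrite !in_itv/= => /andP[ut tv];
      rewrite (le_trans au (ltW ut)) (le_trans tv vb).
  have avab : `[a, v]%classic `<=` `[a, b]%classic.
    by move=> t /=; rewrite !in_itv/= => /andP[-> tv]; rewrite (le_trans tv vb).
  have ifuv : lebesgue_measure.-integrable `]u, v]%classic (EFin \o f_ n).
    exact: integrableS (if_ n).
  have -> : sigma_ n v - sigma_ n u =
    \int[lebesgue_measure]_(t in `]u, v]) f_ n t.
    rewrite (sigmaE n v) ?(le_trans au uv)//
      (sigmaE n u) ?au ?(le_trans uv vb)//.
    rewrite opprD addrACA subrr add0r Rintegral_itvB ?bnd_simp//.
    exact: integrableS (if_ n).
  have ae_filter := ae_filter_ringOfSetsType (@lebesgue_measure R).
  apply/andP; split.
    have -> : C * (v - u) = \int[lebesgue_measure]_(t in `]u, v]) C.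
      rewrite Rintegral_cst//; congr (_ * _);
        rewrite [X in fine X]lebesgue_measure_itv/= lte_fin.
      case: ltP => // vu; rewrite (_ : v = u) ?subrr//.
      by apply/eqP; rewrite eq_le vu.
    apply: ae_le_Rintegral => //.
      apply: measurable_bounded_integrable => //.
        by rewrite [ltLHS]lebesgue_measure_itv/=; case: ifP => _; rewrite ltry.
      exists `|C|; split => // M CM t _; exact: ltW.
    apply: (filterS _ (Cfg n)) => t /= + tuv; move=> /(_ _)/andP[]//.
    exact: (uvab _ tuv).
  apply: ae_le_Rintegral => //; first exact: integrableS ih.
  apply: filterS (Cfg n) => t /= + tuv.
  have tab : t \in `[a, b] := uvab _ tuv.
  move=> /(_ tab)/andP[_ /le_trans]; apply.
  by rewrite /h patchE mem_set// ler_norm.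
have [nu nuE] := scalar_measure_on_RL P (P `]a, b[%classic e0).
have [nul [f [mf fh fE]]] : nu `<< lebesgue_measure /\ exists f : R -> R,
    [/\ @measurable_fun _ _ (measurableTypeR R) R setT f,
     forall x, 0 <= f x <= h x &
     forall D : set (measurableTypeR R), measurable D ->
       nu D = (\int[lebesgue_measure]_(t in D) (f t)%:E)%E].
  apply: bounded_density => // x y xy;
    rewrite nuE scalar_measure_hnorm -massE// lee_fin.
  exact: (limit_measure_le saA_ AP_ saA AP PhiA cvgA graphA h0 ih F_bound).
have sigmaB (e : H) u v : a <= u -> u <= v -> v <= b ->
    (spectral_function b P e v - spectral_function b P e u)%:E =
    scalar_measure P (P `]a, b[%classic e) `]u, v]%classic.
  by move=> au uv vb; rewrite (spectral_functionB P e au uv vb)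
    scalar_measure_hnorm.
split.
- split.
    move=> l /andP[al lb]; apply: (spectrum_of_support saA AP) => e e_gt0.
    pose u := Num.max a (l - e); pose v := Num.min b (l + e).
    have au : a <= u by rewrite le_max lexx.
    have vb : v <= b by rewrite ge_min lexx.
    have lu : l - e <= u by rewrite le_max lexx orbT.
    have vl : v <= l + e by rewrite ge_min lexx orbT.
    have uv : u < v by rewrite gt_max !lt_min ab/=; apply/andP; split;
      [|apply/andP; split]; lra.
    (* The middle third of [`]u, v]] stays away from [a] and [b]. *)
    exists ((2 * u + v) / 3), ((u + 2 * v) / 3), e0; split; [lra|lra|].
    by apply: (limit_increment_gt0 saA_ AP_ saA AP PhiA cvgA graphA C0
      F_bound); lra.
  move=> e; have [nue nueE] := scalar_measure_on_RL P (P `]a, b[%classic e).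
  apply: (@absolutely_continuous_on_measure _ nue); last first.
    by move=> u v au uv vb; rewrite nueE; exact: sigmaB.
  apply/null_content_dominatesP => D mD D0.
  have : nu D = 0%E by move/null_content_dominatesP : nul; exact.
  rewrite nuE nueE !scalar_measure_hnorm => -[/eqP];
    rewrite sqrf_eq0 => /eqP/hnorm0_eq0.
  rewrite !pvmI// => /(generating_vector_eq0
    (measurableI _ _ mD (measurable_itv _)) gen) ->.
  by rewrite hnorm0 expr0n.
- exists f.
    apply: (Lp_on_le p1 mf _ gp) => t; have /andP[f0 fle] := fh t.
    by rewrite ger0_norm.
  move=> l /andP[al lb]; apply/eqP; rewrite addrC -subr_eq; apply/eqP/EFin_inj.
  have if0 : lebesgue_measure.-integrable setT (EFin \o f).
    apply: le_integrable ih => //; first exact/measurable_EFinP.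
    by move=> t _; have /andP[f0 fle] := fh t; rewrite /= lee_fin !ger0_norm.
  rewrite sigmaB// -nuE fE// -Rintegral_itv_obnd_cbnd;
    last exact: integrableS if0.
  rewrite /Rintegral fineK//; apply: integrable_fin_num => //;
    exact: integrableS if0.
- move=> U /uniform_nbhs[E [entE EU]].
  move: entE; rewrite -entourage_ballE => -[d /= d0 dE].
  have := uniform_cvg_spectral_function saA_ AP_ saA AP PhiA cvgA graphA ab h0
    ih C0 F_bound d0.
  apply: filterS => n close; apply: EU => l /= lab; apply: dE => /=.
  rewrite -ball_normE/= distrC; apply: close; by rewrite in_itv in lab.
Qed.
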